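(* For $n\ge0$ let $$c_n=\frac{\binom{2n}{n}^4}{2^{8n}},\qquad b_n=\frac1{4n+1}+2\sum_{k=0}^{2n-1}\frac1{2k+1}$$ (the inner sum being empty for $n=0$). Then $$\sum_{n=0}^{\infty}c_nb_n=\frac{\pi^2}{8}\;{}_7F_6\!\left(\begin{matrix}\frac54,\frac12,\frac12,\frac12,\frac12,\frac12,\frac12\\ \frac14,1,1,1,1,1\end{matrix};1\right).$$ Consequently, with $s_{4,0}:=\int_0^\infty I_0(t)K_0(t)^3\,dt$, $$s_{4,0}=\frac{\pi^4}{16}\;{}_7F_6\!\left(\begin{matrix}\frac54,\frac12,\frac12,\frac12,\frac12,\frac12,\frac12\\ \frac14,1,1,1,1,1\end{matrix};1\right).$$
   Context: $I_0$ and $K_0$ are the modified Bessel functions of the first and second kinds of order zero. ${}_7F_6$ is the generalized hypergeometric series ${}_pF_q(a_1,\dots,a_p;b_1,\dots,b_q;z)=\sum_{n\ge0}\frac{(a_1)_n\cdots(a_p)_n}{(b_1)_n\cdots(b_q)_n}\frac{z^n}{n!}$ with $(a)_0=1$, $(a)_n=a(a+1)\cdots(a+n-1)$ (upper row: the $a_i$; lower row: the $b_j$). Known result of Bailey, Borwein, Broadhurst and Glasser, which the paper takes as given: $s_{4,0}=\frac{\pi^2}{2}\sum_{n=0}^\infty c_nb_n$. *)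

(* Defs.v *)
From Stdlib Require Import Reals Factorial List.
From Coquelicot Require Import Coquelicot.
Import ListNotations.
Open Scope R_scope.

Fixpoint pochhammer (a : R) (n : nat) : R :=
  match n with
  | O => 1
  | S m => pochhammer a m * (a + INR m)
  end.

Definition prod_list (l : list R) : R := fold_right Rmult 1 l.

Definition pFq_term (a b : list R) (z : R) (n : nat) : R :=
  prod_list (map (fun x => pochhammer x n) a)
  / prod_list (map (fun x => pochhammer x n) b)
  * (z ^ n / INR (fact n)).

Definition pFq (a b : list R) (z : R) : R := Series (pFq_term a b z).

(* [sum_n a m] has m + 1 terms, so the empty sum needs its own case. *)
Definition sum_lt (a : nat -> R) (n : nat) : R :=
  match n with
  | O => 0
  | S m => sum_n a m
  end.

(* [Binomial.C] is the binomial coefficient; Coquelicot shadows the short name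
   with the complex numbers. *)
Definition c (n : nat) : R := Binomial.C (2 * n) n ^ 4 / 2 ^ (8 * n).

Definition b (n : nat) : R :=
  1 / (4 * INR n + 1) + 2 * sum_lt (fun k => 1 / (2 * INR k + 1)) (2 * n).

Definition I0 (t : R) : R :=
  Series (fun k => (t / 2) ^ (2 * k) / INR (fact k) ^ 2).

(* The classical integral K_0(t) = int_0^oo exp(-t cosh u) du, which converges
   exactly for t > 0; elsewhere the value of [K0] is meaningless. *)
Definition K0 (t : R) : R :=
  RInt_gen (fun u => exp (- (t * cosh u))) (at_point 0) (Rbar_locally p_infty).

(* "The improper integral s_{4,0} over (0, oo) converges, with value l."  It is
   improper at both ends: K_0 has a logarithmic singularity at 0. *)
Definition is_s40 (l : R) : Prop :=
  is_RInt_gen (fun t => I0 t * K0 t ^ 3) (at_right 0) (Rbar_locally p_infty) l.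

Definition upper : list R := [5/4; 1/2; 1/2; 1/2; 1/2; 1/2; 1/2].
Definition lower : list R := [1/4; 1; 1; 1; 1; 1].

(* Main.v *)
(* Write [a_n = C(2n,n) / 4^n].  With [K(k) = PI/2 sum a_n^2 k^(2n)] and [K'(x) =
   K(sqrt (1 - x^2))], both sides are multiples of the integral of [K'^2] over [[0, 1]].

   Since [sum_{j<n} a_j^2 / (2n+2j+1) = a_n^2 sum_{k<2n} 1 / (2k+1)], grouping the terms of
   [sum_{m,r} a_m^2 a_r^2 / (2m+2r+1)] by [max m r] gives [sum c_n b_n]; this double sum is
   [4/PI^2] times the integral of [K^2].  On the other side,
   [K'(x) = PI^2/4 sum (4n+1) (-1)^n a_n^3 P_{2n}(x)], so Parseval's identity turns the
   integral of [K'^2] into [PI^4/16 sum (4n+1) a_n^6], the 7F6.  Expanded in powers of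
   [1 - x^2] this is a rearrangement of series with positive terms, based on Dougall's 5F4 sum
   and Gauss's 2F1 sum.  Finally the substitution [x = (1-k)/(1+k)] and Landen's
   transformation [K'((1-k)/(1+k)) = (1+k) K(k)] show that the integral of [K'^2] is twice
   that of [K^2]. *)

Require Import Defs.
From Stdlib Require Import Reals List Lra Lia Factorial.
From Coquelicot Require Import Coquelicot.
Open Scope R_scope.

(** * Wallis ratios *)

(** The numbers a_n of the overview, equal to (1/2)_n / n!. The recursive form exposes the ratio of
    consecutive terms, which is what the telescoping identities below need. *)
Fixpoint wallis (n : nat) : R :=
  match n with
  | O => 1
  | S m => wallis m * ((2 * INR m + 1) / (2 * INR m + 2))
  end.

(* [K(k) = PI/2 * PSeries wallis2 (k^2)]. *)
Definition wallis2 (n : nat) : R := wallis n ^ 2.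

Lemma wallis_S (n : nat) : wallis (S n) = wallis n * ((2 * INR n + 1) / (2 * INR n + 2)).
Proof. reflexivity. Qed.

Lemma wallis_pos (n : nat) : 0 < wallis n.
Proof.
  induction n as [|n IH]; simpl; [lra|].
  pose proof (pos_INR n). apply Rmult_lt_0_compat; [easy|].
  apply Rdiv_lt_0_compat; lra.
Qed.

Lemma wallis2_pos (n : nat) : 0 < wallis2 n.
Proof. apply pow_lt, wallis_pos. Qed.

Lemma wallis2_S (n : nat) : (INR n + 1) ^ 2 * wallis2 (S n) = (INR n + 1 / 2) ^ 2 * wallis2 n.
Proof. unfold wallis2; simpl wallis. pose proof (pos_INR n). field. lra. Qed.

(** The product (2n+1) a_n^2 starts at 1 and decreases, because (2n+1)(2n+3) <= (2n+2)^2. *)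
Lemma wallis2_le (n : nat) : wallis2 n <= 1 / (2 * INR n + 1).
Proof.
  apply (Rle_div_r _ _ (2 * INR n + 1)); [pose proof (pos_INR n); lra|].
  induction n as [|n IH]; [unfold wallis2; simpl; lra|].
  pose proof (pos_INR n) as Hn. pose proof (wallis2_S n) as HS. pose proof (wallis2_pos n).
  rewrite S_INR.
  apply Rle_trans with (wallis2 n * (2 * INR n + 1)); [|easy].
  apply Rmult_le_reg_l with ((INR n + 1) ^ 2); [nra|].
  rewrite <- !Rmult_assoc, HS.
  replace ((INR n + 1) ^ 2 * wallis2 n * (2 * INR n + 1))
    with (wallis2 n * ((INR n + 1) ^ 2 * (2 * INR n + 1))) by ring.
  replace ((INR n + 1 / 2) ^ 2 * wallis2 n * (2 * (INR n + 1) + 1))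
    with (wallis2 n * ((INR n + 1 / 2) ^ 2 * (2 * (INR n + 1) + 1))) by field.
  apply Rmult_le_compat_l; nra.
Qed.

Lemma wallis2_le_1 (n : nat) : wallis2 n <= 1.
Proof.
  apply Rle_trans with (1 := wallis2_le n). pose proof (pos_INR n).
  apply (Rle_div_l _ _ (2 * INR n + 1)); lra.
Qed.

Lemma wallis_le_1 (n : nat) : wallis n <= 1.
Proof.
  pose proof (wallis_pos n). pose proof (wallis2_le_1 n). unfold wallis2 in *. nra.
Qed.

Lemma pochhammer_1 (n : nat) : pochhammer 1 n = INR (fact n).
Proof.
  induction n as [|n IH]; [simpl; lra|].
  simpl pochhammer. rewrite IH. change (fact (S n)) with ((S n) * fact n)%nat.
  rewrite mult_INR, S_INR. ring.
Qed.

Lemma pochhammer_half (n : nat) : pochhammer (1 / 2) n = wallis n * INR (fact n).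
Proof.
  induction n as [|n IH]; [simpl; lra|].
  simpl pochhammer. rewrite IH. change (fact (S n)) with ((S n) * fact n)%nat.
  rewrite mult_INR, S_INR. simpl wallis. pose proof (pos_INR n). field. lra.
Qed.

Lemma pochhammer_pos (x : R) (n : nat) : 0 < x -> 0 < pochhammer x n.
Proof.
  intros Hx. induction n as [|n IH]; simpl; [lra|].
  pose proof (pos_INR n). apply Rmult_lt_0_compat; lra.
Qed.

(** Both sides are the product x (x+1) ... (x+n). At x = 1/4 this turns (5/4)_n / (1/4)_n into
    4n+1. *)
Lemma pochhammer_shift (x : R) (n : nat) :
  x * pochhammer (x + 1) n = (x + INR n) * pochhammer x n.
Proof.
  induction n as [|n IH]; [simpl; ring|].
  simpl pochhammer. rewrite S_INR, <- Rmult_assoc, IH. ring.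
Qed.

(** The six factors (1/2)_n on top meet five factors (1)_n = n! and the n! of the series, which
    leaves six Wallis ratios. *)
Lemma pFq_term_upper_lower (n : nat) :
  pFq_term upper lower 1 n = (4 * INR n + 1) * wallis n ^ 6.
Proof.
  unfold pFq_term, upper, lower, prod_list. simpl map. simpl fold_right.
  rewrite pochhammer_1, pochhammer_half, pow1.
  pose proof (pochhammer_shift (1 / 4) n) as E.
  replace (1 / 4 + 1) with (5 / 4) in E by field.
  replace (pochhammer (5 / 4) n)
    with ((4 * INR n + 1) * pochhammer (1 / 4) n) by lra.
  assert (0 < pochhammer (1 / 4) n) by (apply pochhammer_pos; lra).
  pose proof (INR_fact_lt_0 n).
  field. split; lra.
Qed.

Lemma fact_double_wallis (n : nat) :
  INR (fact (2 * n)) = wallis n * 4 ^ n * INR (fact n) ^ 2.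
Proof.
  induction n as [|n IH]; [simpl; lra|].
  replace (2 * S n)%nat with (S (S (2 * n))) by lia.
  change (fact (S (S (2 * n))))
    with ((S (S (2 * n))) * ((S (2 * n)) * fact (2 * n)))%nat.
  change (fact (S n)) with ((S n) * fact n)%nat.
  rewrite !mult_INR, IH, !S_INR, mult_INR. simpl wallis.
  change (4 ^ S n) with (4 * 4 ^ n). change (INR 2) with 2.
  pose proof (pos_INR n). field. lra.
Qed.

Lemma c_wallis2 (n : nat) : c n = wallis2 n ^ 2.
Proof.
  unfold c, Binomial.C. replace (2 * n - n)%nat with n by lia.
  rewrite fact_double_wallis, pow_mult.
  replace (2 ^ 8) with (4 ^ 4) by ring.
  rewrite <- (pow_mult 4 4 n), (Nat.mul_comm 4 n), pow_mult. unfold wallis2.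
  pose proof (INR_fact_lt_0 n). assert (0 < 4 ^ n) by (apply pow_lt; lra).
  field. lra.
Qed.

(** * Odd harmonic sums and the partial sums of c_n b_n *)

Definition odd_harm (n : nat) : R := sum_lt (fun k => 1 / (2 * INR k + 1)) n.

Lemma sum_lt_S (u : nat -> R) (n : nat) : sum_lt u (S n) = sum_lt u n + u n.
Proof. destruct n; simpl; [rewrite sum_O; ring|]. exact (sum_Sn u n). Qed.

Lemma sum_lt_telescope (u v : nat -> R) (n : nat) :
  (forall j, u j = v (S j) - v j) -> sum_lt u n = v n - v 0%nat.
Proof.
  intros H. induction n as [|n IH]; [simpl; ring|].
  rewrite sum_lt_S, IH, H. ring.
Qed.

Lemma sum_lt_plus (u v : nat -> R) (n : nat) :
  sum_lt (fun j => u j + v j) n = sum_lt u n + sum_lt v n.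
Proof. induction n as [|n IH]; [simpl; ring|]. rewrite !sum_lt_S, IH. ring. Qed.

Lemma sum_lt_scal (x : R) (u : nat -> R) (n : nat) :
  sum_lt (fun j => x * u j) n = x * sum_lt u n.
Proof. induction n as [|n IH]; [simpl; ring|]. rewrite !sum_lt_S, IH. ring. Qed.

Lemma sum_lt_ext (u v : nat -> R) (n : nat) :
  (forall j, u j = v j) -> sum_lt u n = sum_lt v n.
Proof. intros H. induction n as [|n IH]; [easy|]. rewrite !sum_lt_S, IH, H. easy. Qed.

(** Induction on n by creative telescoping: (2n+2)^2 times the summand for n+1, minus (2n+1)^2 times
    the summand for n, is a difference in j. This relates the two rows up to a boundary term. *)
Lemma wallis2_cauchy_row (n : nat) :
  sum_lt (fun j => wallis2 j / (2 * INR n + 2 * INR j + 1)) n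
  = wallis2 n * odd_harm (2 * n).
Proof.
  induction n as [|n IH]; [simpl; unfold odd_harm; simpl; ring|].
  pose proof (pos_INR n) as Hn.
  pose proof (sum_lt_telescope
    (fun j => (2 * INR n + 2) ^ 2 * (wallis2 j / (2 * INR (S n) + 2 * INR j + 1))
              + (- (2 * INR n + 1) ^ 2) * (wallis2 j / (2 * INR n + 2 * INR j + 1)))
    (fun j => 4 * INR j ^ 2 * wallis2 j / (2 * INR n + 2 * INR j + 1)) n) as T.
  rewrite sum_lt_plus, !sum_lt_scal, IH in T.
  rewrite sum_lt_S. replace (2 * S n)%nat with (S (S (2 * n))) by lia.
  unfold odd_harm in *. rewrite !sum_lt_S.
  set (X := sum_lt (fun j => wallis2 j / (2 * INR (S n) + 2 * INR j + 1)) n) in *.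
  set (h := sum_lt (fun k => 1 / (2 * INR k + 1)) (2 * n)) in *.
  pose proof (wallis2_S n) as HS.
  assert (E : wallis2 (S n) = (INR n + 1 / 2) ^ 2 * wallis2 n / (INR n + 1) ^ 2)
    by (rewrite <- HS; field; lra).
  rewrite E. clear E HS.
  (* After a_{j+1}^2 is reduced to a_j^2, this holds because (2n+2)^2 - (2j+1)^2 divided by 2n+2j+3
     and (2n+1)^2 - (2j)^2 divided by 2n+2j+1 are both 2n-2j+1. *)
  assert (HT : forall j : nat,
    (2 * INR n + 2) ^ 2 * (wallis2 j / (2 * INR (S n) + 2 * INR j + 1))
      + (- (2 * INR n + 1) ^ 2) * (wallis2 j / (2 * INR n + 2 * INR j + 1))
    = 4 * INR (S j) ^ 2 * wallis2 (S j) / (2 * INR n + 2 * INR (S j) + 1)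
      - 4 * INR j ^ 2 * wallis2 j / (2 * INR n + 2 * INR j + 1)).
  { intros j. rewrite !S_INR. pose proof (pos_INR j).
    replace (4 * (INR j + 1) ^ 2 * wallis2 (S j)) with (4 * ((INR j + 1 / 2) ^ 2 * wallis2 j))
      by (rewrite <- wallis2_S; ring).
    field. split; lra. }
  specialize (T HT). simpl (INR 0) in T.
  rewrite !S_INR, mult_INR in *. simpl (INR 2).
  (* The telescoped identity solved for [X], the row of n+1 without its last entry j = n. *)
  assert (EX : X = ((2 * INR n + 1) ^ 2 * (wallis2 n * h)
     + 4 * INR n ^ 2 * wallis2 n / (2 * INR n + 2 * INR n + 1)) / (2 * INR n + 2) ^ 2).
  { apply Rmult_eq_reg_l with ((2 * INR n + 2) ^ 2); [|nra].
    replace ((2 * INR n + 2) ^ 2 * X) with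
      ((2 * INR n + 2) ^ 2 * X + - (2 * INR n + 1) ^ 2 * (wallis2 n * h)
        + (2 * INR n + 1) ^ 2 * (wallis2 n * h)) by ring.
    rewrite T. field. lra. }
  rewrite EX. field. lra.
Qed.

Definition square_sum (f : nat -> nat -> R) (M : nat) : R :=
  sum_n (fun m => sum_n (f m) M) M.

Definition antidiag (f : nat -> nat -> R) (k : nat) : R :=
  sum_n (fun i => f i (k - i)%nat) k.

(** Enlarging the square adds a corner and two borders, which are equal by symmetry. *)
Lemma square_sum_S (f : nat -> nat -> R) (M : nat) :
  (forall m r, f m r = f r m) ->
  square_sum f (S M)
  = square_sum f M + (f (S M) (S M) + 2 * sum_lt (f (S M)) (S M)).
Proof.
  intros Hs. unfold square_sum. rewrite sum_Sn.
  rewrite (sum_n_ext _ (fun m => plus (sum_n (f m) M) (f m (S M))))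
    by (intros m; exact (sum_Sn (f m) M)).
  rewrite sum_n_plus, (sum_Sn (f (S M)) M).
  rewrite (sum_n_ext (fun m => f m (S M)) (f (S M))) by (intros m; apply Hs).
  change (sum_lt (f (S M)) (S M)) with (sum_n (f (S M)) M).
  unfold plus; simpl. ring.
Qed.

(** The term c_n b_n collects exactly the pairs with max m r = n: the diagonal entry gives 1/(4n+1)
    and the two borders give the odd harmonic sum. The identity is therefore exact for every finite
    M. *)
Lemma sum_c_b (M : nat) :
  sum_n (fun n => c n * b n) M
  = square_sum (fun m r => wallis2 m * wallis2 r / (2 * INR (m + r) + 1)) M.
Proof.
  assert (Hrow : forall n, c n * b n =
    wallis2 n * wallis2 n / (2 * INR (n + n) + 1)
    + 2 * sum_lt (fun r => wallis2 n * wallis2 r / (2 * INR (n + r) + 1)) n).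
  { intros n. rewrite c_wallis2. unfold b. fold (odd_harm (2 * n)).
    rewrite (sum_lt_ext _ (fun r => wallis2 n * (wallis2 r / (2 * INR n + 2 * INR r + 1)))).
    2:{ intros j. rewrite plus_INR. pose proof (pos_INR n). pose proof (pos_INR j).
        field. lra. }
    rewrite sum_lt_scal, wallis2_cauchy_row, plus_INR.
    pose proof (pos_INR n). field. lra. }
  induction M as [|M IH].
  - unfold square_sum. rewrite !sum_O, Hrow. simpl. ring.
  - rewrite sum_Sn, IH, square_sum_S, Hrow; [reflexivity|].
    intros m r. rewrite (Nat.add_comm m r), (Rmult_comm (wallis2 m)). reflexivity.
Qed.

(** * Legendre expansion of K' *)

(* The integral of [(1 - y^2)^k] over [[0, 1]]. *)
Fixpoint beta_half (k : nat) : R :=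
  match k with
  | O => 1
  | S j => beta_half j * ((2 * INR j + 2) / (2 * INR j + 3))
  end.

Lemma beta_half_pos (k : nat) : 0 < beta_half k.
Proof.
  induction k as [|k IH]; simpl; [lra|]. pose proof (pos_INR k).
  apply Rmult_lt_0_compat; [easy|]. apply Rdiv_lt_0_compat; lra.
Qed.

Lemma wallis_beta_half (k : nat) : (2 * INR k + 1) * (wallis k * beta_half k) = 1.
Proof.
  induction k as [|k IH]; [simpl; lra|].
  rewrite S_INR. simpl. pose proof (pos_INR k).
  transitivity ((2 * INR k + 1) * (wallis k * beta_half k)); [field; lra | exact IH].
Qed.

(* Up to the factor [(-1)^n wallis n], [lmoment n r] is the integral of
   [(1 - y^2)^r P_{2n}(y)] over [[0, 1]]; the recursion makes it vanish for [r < n]. *)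
Fixpoint lmoment (n r : nat) : R :=
  match n with
  | O => beta_half r
  | S i => lmoment i r * (INR r - INR i) / (INR r + INR i + 3 / 2)
  end.

Lemma lmoment_S (n r : nat) :
  lmoment (S n) r = lmoment n r * (INR r - INR n) / (INR r + INR n + 3 / 2).
Proof. reflexivity. Qed.

Lemma lmoment_zero (n r : nat) : (r < n)%nat -> lmoment n r = 0.
Proof.
  induction n as [|n IH]; intros H; [lia|]. simpl.
  pose proof (pos_INR n). pose proof (pos_INR r).
  destruct (Nat.eq_dec r n) as [->|].
  - unfold Rdiv. ring.
  - rewrite IH by lia. unfold Rdiv. ring.
Qed.

(** The factors (r-i)/(r+i+3/2) lie in [0, 1] for i <= r, and the factor i = r annihilates
    everything beyond. *)
Lemma lmoment_bounds (n r : nat) : 0 <= lmoment n r <= beta_half r.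
Proof.
  induction n as [|n IH]; [simpl; pose proof (beta_half_pos r); lra|].
  destruct (Compare_dec.le_lt_dec n r) as [H|H].
  - simpl. pose proof (pos_INR n). pose proof (pos_INR r). apply le_INR in H.
    assert (0 <= (INR r - INR n) / (INR r + INR n + 3 / 2) <= 1).
    { split; [apply Rdiv_le_0_compat; lra|].
      apply (Rle_div_l _ _ (INR r + INR n + 3 / 2)); lra. }
    unfold Rdiv in *. rewrite Rmult_assoc. nra.
  - rewrite lmoment_zero by lia. pose proof (beta_half_pos r). lra.
Qed.

(** In the product over i < n that defines [lmoment n r], a shift of r cancels all but the end
    factors. Denominators are cleared so that the relation also covers r + 1 = n, where the left
    factor vanishes. *)
Lemma lmoment_S_r (n r : nat) :
  (INR r + 1 - INR n) * (INR r + INR n + 3 / 2) * lmoment n (S r)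
  = (INR r + 1) ^ 2 * lmoment n r.
Proof.
  induction n as [|n IH].
  - simpl. pose proof (pos_INR r). field. lra.
  - rewrite !lmoment_S, !S_INR. pose proof (pos_INR r). pose proof (pos_INR n).
    replace ((INR r + 1) ^ 2 * (lmoment n r * (INR r - INR n) / (INR r + INR n + 3 / 2)))
      with ((INR r - INR n) / (INR r + INR n + 3 / 2) * ((INR r + 1) ^ 2 * lmoment n r))
      by (field; lra).
    rewrite <- IH. field. lra.
Qed.

(* Parseval for the even Legendre polynomials on [[0, 1]]. *)
Lemma dougall_5F4 (N m r : nat) : (r <= N)%nat ->
  sum_n (fun n => (4 * INR n + 1) * wallis2 n * (lmoment n m * lmoment n r)) N = beta_half (m + r).
Proof.
  intros HN. change (sum_n ?u N) with (sum_lt u (S N)).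
  induction m as [|m IH].
  - assert (H : forall M,
      sum_lt (fun n => (4 * INR n + 1) * wallis2 n * (lmoment n 0 * lmoment n r)) (S M)
      = beta_half r).
    { induction M as [|M IH].
      - simpl. rewrite sum_O. unfold wallis2. simpl. ring.
      - rewrite sum_lt_S, IH, (lmoment_zero (S M) 0) by lia. ring. }
    apply H.
  - set (F := fun m n => (4 * INR n + 1) * wallis2 n * (lmoment n m * lmoment n r)) in *.
    change (sum_lt (F m) (S N) = beta_half (m + r)) in IH.
    change (sum_lt (F (S m)) (S N) = beta_half (S m + r)).
    pose proof (pos_INR m) as Hm. pose proof (pos_INR r) as Hr.
    (* A Wilf-Zeilberger certificate for the recurrence in m. It vanishes at n = 0 through the
       factor n^2, and at n = N + 1 because r <= N. What remains is the recursion of [beta_half] at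
       m + r. *)
    set (v := fun n => - 2 * (INR n ^ 2 * wallis2 n) * (INR m + INR n + 3 / 2)
                       * (INR r + INR n + 1 / 2) * (lmoment n (S m) * lmoment n r)).
    pose proof (sum_lt_telescope
      (fun n => ((INR m + 1) ^ 2 * (INR m + INR r + 3 / 2)) * F (S m) n
                + (- ((INR m + 1) ^ 2 * (INR m + INR r + 1))) * F m n) v (S N)) as T.
    rewrite sum_lt_plus, !sum_lt_scal, IH in T.
    assert (v (S N) = 0) as Hv by (unfold v; rewrite (lmoment_zero (S N) r) by lia; ring).
    assert (v 0%nat = 0) as Hv0 by (unfold v; simpl; ring).
    rewrite Hv, Hv0 in T.
    simpl beta_half. rewrite plus_INR.
    apply Rmult_eq_reg_l with ((INR m + 1) ^ 2 * (INR m + INR r + 3 / 2)); [|nra].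
    assert (forall j, (INR m + 1) ^ 2 * (INR m + INR r + 3 / 2) * F (S m) j
      + - ((INR m + 1) ^ 2 * (INR m + INR r + 1)) * F m j = v (S j) - v j) as HT.
    { intros n. unfold F, v.
      pose proof (lmoment_S_r n m) as E. rewrite !S_INR. pose proof (pos_INR n).
      replace (- ((INR m + 1) ^ 2 * (INR m + INR r + 1)) *
        ((4 * INR n + 1) * wallis2 n * (lmoment n m * lmoment n r))) with
        (- (INR m + INR r + 1) *
        ((4 * INR n + 1) * wallis2 n * (((INR m + 1) ^ 2 * lmoment n m) * lmoment n r))) by ring.
      rewrite <- E, wallis2_S. rewrite !lmoment_S, !S_INR. field. lra. }
    specialize (T HT). apply Rminus_diag_uniq. rewrite Rminus_0_r in T.
    etransitivity; [|exact T]. field. lra.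
Qed.

(** * Power series of the arcsine *)

Lemma CV_radius_ge_1 (u : nat -> R) (x : R) :
  (forall n, Rabs (u n) <= 1) -> Rabs x < 1 -> Rbar_lt (Rabs x) (CV_radius u).
Proof.
  intros Hu Hx. apply Rbar_lt_le_trans with 1; [easy|].
  apply (proj1 (CV_radius_bounded u)). exists 1. intros n.
  rewrite pow1, Rmult_1_r. apply Hu.
Qed.

Lemma is_series_nonneg_bounded (u : nat -> R) (B : R) :
  (forall n, 0 <= u n) -> (forall n, sum_n u n <= B) ->
  exists l, is_series u l /\ l <= B.
Proof.
  intros Hu HB.
  destruct (ex_finite_lim_seq_incr (sum_n u) B) as [l Hl]; [|easy|].
  - intros n. rewrite sum_Sn. specialize (Hu (S n)). unfold plus; simpl. lra.
  - exists l. split; [exact Hl|].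
    exact (is_lim_seq_le _ (fun _ => B) l B HB Hl (is_lim_seq_const B)).
Qed.

Lemma sum_n_le_series (u : nat -> R) (l : R) (n : nat) :
  (forall n, 0 <= u n) -> is_series u l -> sum_n u n <= l.
Proof.
  intros Hu Hl. apply (is_lim_seq_incr_compare (sum_n u)); [exact Hl|].
  intros m. rewrite sum_Sn. specialize (Hu (S m)). unfold plus; simpl. lra.
Qed.

Lemma sum_n_le_PSeries (u : nat -> R) (z : R) (n : nat) :
  (forall n, 0 <= u n <= 1) -> 0 <= z < 1 ->
  sum_n (fun k => u k * z ^ k) n <= PSeries u z.
Proof.
  intros Hu Hz. apply sum_n_le_series.
  - intros k. apply Rmult_le_pos; [apply Hu|]. apply pow_le. lra.
  - apply Series_correct. apply (ex_series_ext (fun k => scal (pow_n z k) (u k))).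
    + intros k. rewrite pow_n_pow. unfold scal; simpl. unfold mult; simpl. ring.
    + apply CV_radius_inside. apply CV_radius_ge_1.
      * intros k. rewrite Rabs_pos_eq; apply Hu.
      * rewrite Rabs_pos_eq; lra.
Qed.

Lemma PSeries_le_series (u v : nat -> R) (l z : R) :
  (forall n, 0 <= u n <= v n) -> 0 <= z <= 1 -> is_series v l -> PSeries u z <= l.
Proof.
  intros Hu Hz Hl. rewrite <- (is_series_unique _ _ Hl). apply Series_le.
  - intros n. assert (0 <= z ^ n <= 1).
    { split; [apply pow_le; lra|]. rewrite <- (pow1 n). apply pow_incr. lra. }
    specialize (Hu n). split; nra.
  - now exists l.
Qed.

Lemma nonneg_derive_le (f df : R -> R) (x y : R) : x <= y ->
  (forall t, x <= t <= y -> is_derive f t (df t)) ->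
  (forall t, x <= t <= y -> 0 <= df t) -> f x <= f y.
Proof.
  intros Hxy Hd Hp. destruct (MVT_gen f x y df) as [t [Ht E]].
  - intros t Ht. rewrite Rmin_left, Rmax_right in Ht by easy. apply Hd. lra.
  - intros t Ht. rewrite Rmin_left, Rmax_right in Ht by easy.
    apply derivable_continuous_pt. exists (df t). apply is_derive_Reals, Hd. lra.
  - rewrite Rmin_left, Rmax_right in Ht by easy. specialize (Hp t Ht). nra.
Qed.

Lemma zero_derive_eq (f : R -> R) (x y : R) : x <= y ->
  (forall t, x <= t <= y -> ex_derive f t) ->
  (forall t, x < t < y -> is_derive f t 0) -> f x = f y.
Proof.
  intros Hxy Hc Hd. destruct (MVT_gen f x y (fun _ => 0)) as [t [Ht E]].
  - intros t Ht. rewrite Rmin_left, Rmax_right in Ht by easy. now apply Hd.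
  - intros t Ht. rewrite Rmin_left, Rmax_right in Ht by easy.
    destruct (Hc t Ht) as [d Hdt].
    apply derivable_continuous_pt. exists d. now apply is_derive_Reals.
  - lra.
Qed.

Lemma PSeries_linear (u v d : nat -> R) (x y z : R) :
  ex_pseries u z -> ex_pseries v z -> (forall n, d n = x * u n + y * v n) ->
  PSeries d z = x * PSeries u z + y * PSeries v z.
Proof.
  intros Hu Hv E. rewrite <- !PSeries_scal, <- PSeries_plus.
  - apply PSeries_ext, E.
  - apply ex_pseries_scal; [apply Rmult_comm|easy].
  - apply ex_pseries_scal; [apply Rmult_comm|easy].
Qed.

Lemma Rabs_wallis (n : nat) : Rabs (wallis n) <= 1.
Proof. pose proof (wallis_pos n). pose proof (wallis_le_1 n). rewrite Rabs_pos_eq; lra. Qed.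

Lemma Rabs_wallis2 (n : nat) : Rabs (wallis2 n) <= 1.
Proof. pose proof (wallis2_pos n). pose proof (wallis2_le_1 n). rewrite Rabs_pos_eq; lra. Qed.

Lemma derive_PSeries_wallis (z : R) : Rabs z < 1 ->
  (1 - z) * PSeries (PS_derive wallis) z = PSeries wallis z / 2.
Proof.
  intros Hz. assert (Hr := CV_radius_ge_1 wallis z Rabs_wallis Hz).
  assert (ex_pseries (PS_derive wallis) z) by now apply ex_pseries_derive.
  replace ((1 - z) * PSeries (PS_derive wallis) z) with
    (PSeries (PS_derive wallis) z - z * PSeries (PS_derive wallis) z) by ring.
  rewrite <- PSeries_incr_1, <- PSeries_minus; [|easy|now apply ex_pseries_incr_1].
  replace (PSeries wallis z / 2) with (/ 2 * PSeries wallis z) by field.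
  rewrite <- PSeries_scal. apply PSeries_ext. intros n.
  unfold PS_minus, PS_plus, PS_opp, PS_scal, PS_derive, PS_incr_1.
  cbn -[INR wallis]. rewrite wallis_S.
  destruct n as [|n]; [simpl; field|].
  rewrite !S_INR. pose proof (pos_INR n). field. lra.
Qed.

(** The generating function is (1-z)^(-1/2): the equation (1-z) f' = f/2 makes the derivative of f^2
    (1-z) vanish. *)
Lemma PSeries_wallis (z : R) : 0 <= z < 1 -> PSeries wallis z ^ 2 * (1 - z) = 1.
Proof.
  intros Hz.
  enough (HD : forall t, 0 <= t <= z -> is_derive (fun z => PSeries wallis z ^ 2 * (1 - z)) t 0).
  - rewrite <- (zero_derive_eq (fun z => PSeries wallis z ^ 2 * (1 - z)) 0 z).
    + rewrite PSeries_0. simpl. ring.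
    + lra.
    + intros t Ht. exists 0. now apply HD.
    + intros t Ht. apply HD. lra.
  - intros t Ht. assert (Rabs t < 1) by (rewrite Rabs_pos_eq; lra).
    assert (Hd := is_derive_PSeries wallis t (CV_radius_ge_1 wallis t Rabs_wallis H)).
    assert (Hw := derive_PSeries_wallis t H).
    revert Hd Hw. generalize (PSeries (PS_derive wallis) t) as d.
    generalize (PSeries wallis) as f. intros f d Hd Hw. auto_derive.
    + now exists d.
    + replace (Derive (fun x : R => f x) t) with d by (symmetry; now apply is_derive_unique).
      transitivity (2 * f t * ((1 - t) * d) - f t ^ 2); [ring|]. rewrite Hw. field.
Qed.

(** The arcsine series at sin t. The derivative of the left side in t is cos t times the series of
    (1 - sin^2 t)^(-1/2), that is 1. *)
Lemma PSeries_wallis_sin (t : R) : 0 <= t < PI / 2 ->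
  sin t * PSeries (fun n => wallis n / (2 * INR n + 1)) (sin t ^ 2) = t.
Proof.
  intros Ht. set (u := fun n => wallis n / (2 * INR n + 1)).
  assert (Hu : forall n, Rabs (u n) <= 1).
  { intros n. unfold u. pose proof (wallis_pos n). pose proof (wallis_le_1 n). pose proof (pos_INR n).
    rewrite Rabs_pos_eq; [|apply Rlt_le, Rdiv_lt_0_compat; lra].
    apply (Rle_div_l _ _ (2 * INR n + 1)); lra. }
  enough (E : sin 0 * PSeries u (sin 0 ^ 2) - 0 = sin t * PSeries u (sin t ^ 2) - t)
    by (rewrite sin_0 in E; lra).
  set (f0 := fun t => sin t * PSeries u (sin t ^ 2) - t).
  enough (HD : forall s, 0 <= s <= t -> is_derive f0 s 0).
  { apply (zero_derive_eq f0); [lra| |].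
    - intros s Hs. exists 0. now apply HD.
    - intros s Hs. apply HD. lra. }
  intros s Hs. unfold f0.
  assert (Hc : 0 < cos s) by (apply cos_gt_0; lra).
  assert (Hsin : 0 <= sin s) by (apply sin_ge_0; lra).
  assert (Hsc : sin s ^ 2 + cos s ^ 2 = 1) by (rewrite <- !Rsqr_pow2; apply sin2_cos2).
  assert (Hz : 0 <= sin s ^ 2 < 1) by nra.
  assert (Hz' : Rabs (sin s ^ 2) < 1) by (rewrite Rabs_pos_eq; lra).
  assert (Hr := CV_radius_ge_1 u _ Hu Hz').
  assert (Hd := is_derive_PSeries u _ Hr).
  assert (Hw : PSeries u (sin s ^ 2) + 2 * (sin s ^ 2 * PSeries (PS_derive u) (sin s ^ 2))
               = PSeries wallis (sin s ^ 2)).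
  { rewrite <- PSeries_incr_1. symmetry. rewrite <- (Rmult_1_l (PSeries u _)).
    apply PSeries_linear.
    - now apply CV_radius_inside.
    - now apply ex_pseries_incr_1, ex_pseries_derive.
    - intros n. unfold PS_incr_1, PS_derive, u. destruct n as [|n].
      + cbn. field.
      + pose proof (pos_INR n). rewrite S_INR. field. lra. }
  assert (Hcos : PSeries wallis (sin s ^ 2) * cos s = 1).
  { pose proof (PSeries_wallis _ Hz) as E.
    assert (0 < PSeries wallis (sin s ^ 2)).
    { apply Rlt_le_trans with (sum_n (fun k => wallis k * (sin s ^ 2) ^ k) 0).
      - rewrite sum_O. simpl. lra.
      - apply sum_n_le_PSeries; [|easy].
        intros n. pose proof (wallis_pos n). pose proof (wallis_le_1 n). lra. }
    replace (1 - sin s ^ 2) with (cos s ^ 2) in E by lra.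
    rewrite <- Rpow_mult_distr in E.
    apply Rmult_lt_0_compat with (2 := Hc) in H. nra. }
  rewrite <- Hw in Hcos. revert Hd Hcos. generalize (PSeries (PS_derive u) (sin s ^ 2)) as d.
  generalize (PSeries u) as f. intros f d Hd Hcos. auto_derive.
  - now exists d.
  - replace (sin s * (sin s * 1)) with (sin s ^ 2) by ring.
    replace (Derive (fun x : R => f x) (sin s ^ 2)) with d
      by (symmetry; now apply is_derive_unique).
    transitivity ((f (sin s ^ 2) + 2 * (sin s ^ 2 * d)) * cos s - 1); [ring|lra].
Qed.

(** Applied to finite partial sums, this carries bounds from inside the disc of convergence to its
    boundary, in place of Abel's theorem. *)
Lemma le_at_left (f : R -> R) (x y B : R) : x < y -> continuous f y ->
  (forall t, x <= t < y -> f t <= B) -> f y <= B.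
Proof.
  intros Hxy Hc Hf. destruct (Rle_lt_dec (f y) B) as [|Hlt]; [easy|].
  destruct (Hc (fun s => B < s) (open_gt B (f y) Hlt)) as [d Hd].
  set (t := Rmax x (y - d / 2)). pose proof (cond_pos d) as Hdp.
  assert (Ht : x <= t < y /\ y - d / 2 <= t).
  { unfold t. repeat split; [apply Rmax_l| |apply Rmax_r]. apply Rmax_lub_lt; lra. }
  specialize (Hf t (proj1 Ht)).
  assert (B < f t); [apply Hd|lra].
  unfold ball; simpl. unfold AbsRing_ball, abs, minus, plus, opp; simpl.
  apply Rabs_def1; lra.
Qed.

Lemma continuous_sum_n (f : nat -> R -> R) (N : nat) (x : R) :
  (forall k, continuous (f k) x) -> continuous (fun y => sum_n (fun k => f k y) N) x.
Proof.
  intros H. induction N as [|N IH].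
  - apply (continuous_ext (f 0%nat)); [|apply H]. intros y. now rewrite sum_O.
  - apply (continuous_ext (fun y => plus (sum_n (fun k => f k y) N) (f (S N) y))).
    + intros y. now rewrite sum_Sn.
    + now apply (continuous_plus (V := R_NormedModule)).
Qed.

(** Since (2r+1) a_r [beta_half r] = 1, this is the arcsine series at 1. Partial sums at sin t are
    at most t < PI/2, and letting t tend to PI/2 bounds the sum above; conversely each t < PI/2 is
    at most the sum at 1. *)
Lemma series_wallis2_beta_half : is_series (fun r => wallis2 r * lmoment 0 r) (PI / 2).
Proof.
  set (u := fun n => wallis n / (2 * INR n + 1)).
  assert (Hpos : forall n, 0 <= u n <= 1).
  { intros n. unfold u.
    pose proof (wallis_pos n). pose proof (wallis_le_1 n). pose proof (pos_INR n). split.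
    - apply Rlt_le, Rdiv_lt_0_compat; lra.
    - apply (Rle_div_l _ _ (2 * INR n + 1)); lra. }
  pose proof PI_RGT_0 as HPI.
  apply (is_series_ext u).
  { intros n. unfold u, wallis2; simpl lmoment. pose proof (wallis_beta_half n). pose proof (pos_INR n).
    replace (wallis n ^ 2 * beta_half n) with (wallis n * (wallis n * beta_half n)) by ring.
    unfold Rdiv. f_equal. apply Rmult_eq_reg_l with (2 * INR n + 1); [|lra].
    rewrite H. field. lra. }
  assert (Hsin : forall t, 0 <= t < PI / 2 -> 0 <= sin t < 1).
  { intros t Ht. split; [apply sin_ge_0; lra|].
    rewrite <- sin_PI2. apply sin_increasing_1; lra. }
  destruct (is_series_nonneg_bounded u (PI / 2)) as [l [Hl Hle]].
  - apply Hpos.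
  - intros N.
    set (f := fun t => sin t * sum_n (fun k => u k * (sin t ^ 2) ^ k) N).
    replace (sum_n u N) with (f (PI / 2)).
    2:{ unfold f. rewrite sin_PI2, Rmult_1_l. apply sum_n_ext. intros k.
        now rewrite !pow1, Rmult_1_r. }
    apply (le_at_left f 0); [lra| |].
    + apply (continuous_mult sin); [apply (ex_derive_continuous sin); auto_derive; easy|].
      apply (continuous_sum_n (fun k t => u k * (sin t ^ 2) ^ k)). intros k.
      apply (ex_derive_continuous (fun t => u k * (sin t ^ 2) ^ k)). auto_derive. easy.
    + intros t Ht. destruct (Hsin t Ht). unfold f.
      apply Rle_trans with t; [|lra]. 
      apply Rle_trans with (2 := Req_le _ _ (PSeries_wallis_sin t Ht)).
      apply Rmult_le_compat_l; [easy|]. apply sum_n_le_PSeries; [easy|]. nra.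
  - replace (PI / 2) with l; [exact Hl|]. apply Rle_antisym; [easy|].
    apply (le_at_left (fun t => t) 0); [lra|apply continuous_id|].
    intros t Ht. destruct (Hsin t Ht). rewrite <- (PSeries_wallis_sin t Ht).
    fold u. assert (0 <= PSeries u (sin t ^ 2) <= l); [|nra]. split.
    + apply Rle_trans with (sum_n (fun k => u k * (sin t ^ 2) ^ k) 0).
      * rewrite sum_O. simpl. pose proof (Hpos 0%nat). lra.
      * apply sum_n_le_PSeries; [easy|nra].
    + apply (PSeries_le_series u u); [|nra|easy]. intros n. pose proof (Hpos n). lra.
Qed.

(** * Legendre coefficients of K' *)

Lemma is_lim_wallis : is_lim_seq wallis 0.
Proof.
  apply is_lim_seq_spec. intros eps. pose proof (cond_pos eps) as He.
  destruct (INR_unbounded (/ eps ^ 2)) as [N HN].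
  exists N. intros n Hn. rewrite Rminus_0_r.
  pose proof (wallis_pos n). rewrite Rabs_pos_eq by lra.
  pose proof (wallis2_le n) as Hal. apply le_INR in Hn. pose proof (pos_INR n).
  assert (0 < eps ^ 2) by nra.
  assert (1 / (2 * INR n + 1) < eps ^ 2).
  { apply (Rlt_div_l _ _ (2 * INR n + 1)); [lra|].
    apply Rlt_le_trans with (eps ^ 2 * / eps ^ 2 + eps ^ 2).
    - rewrite Rinv_r; lra.
    - nra. }
  unfold wallis2 in Hal. nra.
Qed.

(** Gauss's 2F1 sum, giving up to elementary factors the integral of K' against P_{2n}. The
    induction on n compares the sums for n+1 and n by telescoping in r; the base case is the arcsine
    value. *)
Lemma series_wallis2_lmoment (n : nat) :
  is_series (fun r => wallis2 r * lmoment n r) (PI / 2 * wallis2 n).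
Proof.
  induction n as [|n IH].
  { unfold wallis2 at 2; simpl wallis. replace (PI / 2 * 1 ^ 2) with (PI / 2) by ring.
    exact series_wallis2_beta_half. }
  pose proof (pos_INR n) as Hn.
  (* The telescoping certificate. It vanishes at r = 0: by the factor r - n if n = 0, by
     [lmoment n 0] = 0 otherwise. *)
  set (H := fun r => -2 * (4 * INR n + 3) * (INR r - INR n) * (wallis2 r * lmoment n r)).
  assert (HT : forall N, (2 * INR n + 2) ^ 2 * sum_n (fun r => wallis2 r * lmoment (S n) r) N
    = (2 * INR n + 1) ^ 2 * sum_n (fun r => wallis2 r * lmoment n r) N + H (S N)).
  { intros N. change (sum_n ?u N) with (sum_lt u (S N)).
    pose proof (sum_lt_telescope (fun r => (2 * INR n + 2) ^ 2 * (wallis2 r * lmoment (S n) r)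
      + - (2 * INR n + 1) ^ 2 * (wallis2 r * lmoment n r)) H (S N)) as T.
    rewrite sum_lt_plus, !sum_lt_scal in T.
    assert (H0 : H 0%nat = 0).
    { unfold H. destruct n as [|n]; [simpl; ring|]. rewrite (lmoment_zero (S n) 0) by lia. ring. }
    rewrite H0 in T. rewrite <- (Rminus_0_r (H (S N))), <- T; [ring|].
    intros r. unfold H. rewrite lmoment_S. pose proof (pos_INR r) as Hr.
    pose proof (lmoment_S_r n r) as E. pose proof (wallis2_S r) as HA. rewrite !S_INR.
    assert (EA : wallis2 (S r) = (INR r + 1 / 2) ^ 2 * wallis2 r / (INR r + 1) ^ 2)
      by (rewrite <- HA; field; lra).
    replace (-2 * (4 * INR n + 3) * (INR r + 1 - INR n) * (wallis2 (S r) * lmoment n (S r)))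
      with (-2 * (4 * INR n + 3) * wallis2 (S r) / (INR r + INR n + 3 / 2)
            * ((INR r + 1 - INR n) * (INR r + INR n + 3 / 2) * lmoment n (S r)))
      by (field; lra).
    rewrite E, EA. field. lra. }
  assert (HH : is_lim_seq (fun N => H (S N)) 0).
  { apply is_lim_seq_incr_1 with (u := H).
    set (K := 2 * (4 * INR n + 3) * (INR n + 1)).
    (* The boundary term is O(a_r): [lmoment n r] <= [beta_half r] gives (2r+1) a_r^2 [lmoment n r]
       <= a_r, and |r-n| <= (n+1)(2r+1). *)
    assert (Hb : forall r, - (K * wallis r) <= H r <= K * wallis r).
    { intros r. unfold H, K. pose proof (pos_INR r) as Hr.
      pose proof (wallis2_pos r). pose proof (wallis_pos r). pose proof (lmoment_bounds n r).
      pose proof (wallis_beta_half r) as Hw.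
      assert (Hle : (2 * INR r + 1) * (wallis2 r * lmoment n r) <= wallis r).
      { apply Rle_trans with ((2 * INR r + 1) * (wallis2 r * beta_half r)).
        - apply Rmult_le_compat_l; [lra|]. apply Rmult_le_compat_l; lra.
        - unfold wallis2. right.
          transitivity (wallis r * ((2 * INR r + 1) * (wallis r * beta_half r))); [ring|].
          rewrite Hw. ring. }
      assert (0 <= wallis2 r * lmoment n r) by (apply Rmult_le_pos; lra).
      set (q := wallis2 r * lmoment n r) in *.
      assert (Habs : Rabs ((INR r - INR n) * q) <= (INR n + 1) * wallis r).
      { apply Rle_trans with ((INR n + 1) * ((2 * INR r + 1) * q));
          [|apply Rmult_le_compat_l; lra].
        rewrite Rabs_mult, (Rabs_pos_eq q) by easy. rewrite <- Rmult_assoc.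
        apply Rmult_le_compat_r; [easy|]. apply Rabs_le. nra. }
      apply Rabs_le_between in Habs. set (y := (INR r - INR n) * q) in *.
      replace (-2 * (4 * INR n + 3) * (INR r - INR n) * q)
        with (- (2 * (4 * INR n + 3)) * y) by (unfold y; ring).
      split; nra. }
    assert (HK : is_lim_seq (fun r => K * wallis r) 0).
    { replace (Finite 0) with (Rbar_mult K 0) by (simpl; f_equal; ring).
      apply is_lim_seq_scal_l, is_lim_wallis. }
    apply is_lim_seq_le_le with (u := fun r => - (K * wallis r)) (w := fun r => K * wallis r).
    - exact Hb.
    - replace (Finite 0) with (Rbar_opp 0) by (simpl; f_equal; ring).
      now apply is_lim_seq_opp with (u := fun r => K * wallis r) in HK.
    - exact HK. }
  change (is_lim_seq (sum_n (fun r => wallis2 r * lmoment (S n) r)) (PI / 2 * wallis2 (S n))).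
  apply (is_lim_seq_ext (fun N => / (2 * INR n + 2) ^ 2 *
    ((2 * INR n + 1) ^ 2 * sum_n (fun r => wallis2 r * lmoment n r) N + H (S N)))).
  { intros N. rewrite <- HT. field. lra. }
  replace (PI / 2 * wallis2 (S n))
    with (/ (2 * INR n + 2) ^ 2 * ((2 * INR n + 1) ^ 2 * (PI / 2 * wallis2 n) + 0)).
  2:{ pose proof (wallis2_S n) as HA. apply Rmult_eq_reg_l with ((INR n + 1) ^ 2); [|nra].
      replace ((INR n + 1) ^ 2 * (PI / 2 * wallis2 (S n))) with
        (PI / 2 * ((INR n + 1) ^ 2 * wallis2 (S n))) by ring.
      rewrite HA. field. lra. }
  apply (is_lim_seq_scal_l _ (/ (2 * INR n + 2) ^ 2) (Finite _)).
  apply (is_lim_seq_plus' _ _ _ _); [|exact HH].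
  apply (is_lim_seq_scal_l _ ((2 * INR n + 1) ^ 2) (Finite _)). exact IH.
Qed.

(** * The 7F6 series and Parseval's identity for K' *)

Definition term_7F6 (n : nat) : R := (4 * INR n + 1) * wallis n ^ 6.

Lemma term_7F6_pos (n : nat) : 0 < term_7F6 n.
Proof.
  pose proof (pos_INR n). apply Rmult_lt_0_compat; [lra|]. apply pow_lt, wallis_pos.
Qed.

Lemma ex_series_term_7F6 : ex_series term_7F6.
Proof.
  (* [(2n+1) wallis2 n] is at most 1, so the partial sums are dominated by a telescoping series. *)
  assert (Hb : forall n, sum_n term_7F6 n <= 5 - 2 / (2 * INR n + 1)).
  { induction n as [|n IH].
    - rewrite sum_O. unfold term_7F6. simpl. lra.
    - rewrite sum_Sn.
      change (sum_n term_7F6 n + term_7F6 (S n) <= 5 - 2 / (2 * INR (S n) + 1)).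
      assert (Ht : term_7F6 (S n) <= 2 / (2 * INR (S n) + 1) ^ 2).
      { unfold term_7F6. replace (wallis (S n) ^ 6) with (wallis2 (S n) ^ 3) by (unfold wallis2; ring).
        pose proof (wallis2_pos (S n)). pose proof (wallis2_le (S n)). pose proof (pos_INR (S n)).
        apply Rle_trans with (2 * (2 * INR (S n) + 1) * (1 / (2 * INR (S n) + 1)) ^ 3).
        - apply Rmult_le_compat; [lra|apply pow_le; lra|lra|apply pow_incr; lra].
        - right. field. lra. }
      pose proof (pos_INR n) as Hn. rewrite S_INR in Ht |- *.
      assert (2 / (2 * (INR n + 1) + 1) ^ 2
              <= 2 / (2 * INR n + 1) - 2 / (2 * (INR n + 1) + 1)).
      { apply Rminus_le_0.
        replace (2 / (2 * INR n + 1) - 2 / (2 * (INR n + 1) + 1) - 2 / (2 * (INR n + 1) + 1) ^ 2)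
          with ((4 * INR n + 10) / ((2 * INR n + 1) * (2 * (INR n + 1) + 1) ^ 2))
          by (field; lra).
        apply Rlt_le, Rdiv_lt_0_compat; [lra|]. apply Rmult_lt_0_compat; [lra|nra]. }
      lra. }
  destruct (is_series_nonneg_bounded term_7F6 5) as [l [Hl _]].
  - intros n. apply Rlt_le, term_7F6_pos.
  - intros n. specialize (Hb n). pose proof (pos_INR n).
    assert (0 < 2 / (2 * INR n + 1)) by (apply Rdiv_lt_0_compat; lra). lra.
  - now exists l.
Qed.

(** Parseval for K' truncated to a polynomial of degree M in 1 - y^2. All indices r are at most M,
    so Dougall's sum may stop at n = M, and only finite sums are interchanged. *)
Lemma square_sum_beta_half (M : nat) :
  square_sum (fun m r => wallis2 m * wallis2 r * beta_half (m + r)) M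
  = sum_n (fun n => (4 * INR n + 1) * wallis2 n * sum_n (fun r => wallis2 r * lmoment n r) M ^ 2) M.
Proof.
  unfold square_sum.
  transitivity (sum_n (fun m => sum_n (fun n => (4 * INR n + 1) * wallis2 n *
    ((wallis2 m * lmoment n m) * sum_n (fun r => wallis2 r * lmoment n r) M)) M) M).
  - apply sum_n_ext_loc. intros m Hm.
    transitivity (sum_n (fun r => sum_n (fun n =>
       (4 * INR n + 1) * wallis2 n * ((wallis2 m * lmoment n m) * (wallis2 r * lmoment n r))) M) M).
    + apply sum_n_ext_loc. intros r Hr. rewrite <- (dougall_5F4 M m r Hr).
      rewrite <- (sum_n_mult_l (K := R_Ring)). apply sum_n_ext. intros n.
      unfold mult; simpl. ring.
    + rewrite sum_n_switch. apply sum_n_ext. intros n.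
      rewrite <- (sum_n_mult_l (K := R_Ring) (wallis2 m * lmoment n m)).
      rewrite <- (sum_n_mult_l (K := R_Ring) ((4 * INR n + 1) * wallis2 n)).
      reflexivity.
  - rewrite sum_n_switch. apply sum_n_ext. intros n.
    rewrite (sum_n_mult_l (K := R_Ring) ((4 * INR n + 1) * wallis2 n)).
    rewrite (sum_n_mult_r (K := R_Ring)). 
    transitivity ((4 * INR n + 1) * wallis2 n * (sum_n (fun r => wallis2 r * lmoment n r) M
      * sum_n (fun r => wallis2 r * lmoment n r) M)); [reflexivity|].
    generalize (sum_n (fun r => wallis2 r * lmoment n r) M) as x. intros x. simpl in x |- *. ring.
Qed.

Lemma is_lim_sum_n (u : nat -> nat -> R) (l : nat -> R) (N : nat) :
  (forall n, is_lim_seq (u n) (l n)) ->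
  is_lim_seq (fun M => sum_n (fun n => u n M) N) (sum_n l N).
Proof.
  intros H. induction N as [|N IH].
  - rewrite sum_O. apply (is_lim_seq_ext (u 0%nat)); [|apply H]. intros M. now rewrite sum_O.
  - rewrite sum_Sn.
    apply (is_lim_seq_ext (fun M => sum_n (fun n => u n M) N + u (S N) M)).
    + intros M. now rewrite sum_Sn.
    + now apply is_lim_seq_plus'.
Qed.

Lemma sum_n_le (u v : nat -> R) (n : nat) :
  (forall k, u k <= v k) -> sum_n u n <= sum_n v n.
Proof. intros H. now apply sum_n_m_le. Qed.

Lemma sum_n_mono (u : nat -> R) (n m : nat) :
  (forall k, 0 <= u k) -> (n <= m)%nat -> sum_n u n <= sum_n u m.
Proof.
  intros Hu. induction 1 as [|m Hm IH]; [lra|].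
  rewrite sum_Sn. specialize (Hu (S m)). unfold plus; simpl. lra.
Qed.

(** Tannery's argument: the n-th Parseval term [u n M] increases no further than its limit [l n],
    and the [l n] are summable. The sum of all [l n] bounds the square sums above; a fixed number N
    of terms bounds them below. *)
Lemma is_lim_square_sum_beta_half :
  is_lim_seq (square_sum (fun m r => wallis2 m * wallis2 r * beta_half (m + r)))
    (PI ^ 2 / 4 * Series term_7F6).
Proof.
  set (L := PI ^ 2 / 4 * Series term_7F6).
  set (u := fun n M =>
    (4 * INR n + 1) * wallis2 n * sum_n (fun r => wallis2 r * lmoment n r) M ^ 2).
  set (l := fun n => PI ^ 2 / 4 * term_7F6 n).
  assert (Hpos : forall n r, 0 <= wallis2 r * lmoment n r).
  { intros n r. pose proof (wallis2_pos r). pose proof (lmoment_bounds n r). apply Rmult_le_pos; lra. }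
  assert (Hul : forall n M, 0 <= u n M <= l n).
  { intros n M. unfold u, l, term_7F6. pose proof (pos_INR n). pose proof (wallis2_pos n).
    pose proof (sum_n_le_series _ _ M (Hpos n) (series_wallis2_lmoment n)) as Hle.
    assert (Hge : 0 <= sum_n (fun r => wallis2 r * lmoment n r) M).
    { apply Rle_trans with (sum_n (fun r => wallis2 r * lmoment n r) 0).
      - rewrite sum_O. apply Hpos.
      - apply sum_n_mono; [apply Hpos|lia]. }
    replace (PI ^ 2 / 4 * ((4 * INR n + 1) * wallis n ^ 6))
      with ((4 * INR n + 1) * wallis2 n * (PI / 2 * wallis2 n) ^ 2) by (unfold wallis2; field).
    assert (0 <= (4 * INR n + 1) * wallis2 n) by (apply Rmult_le_pos; lra).
    split.
    - apply Rmult_le_pos; [easy|apply pow_le; easy].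
    - apply Rmult_le_compat_l; [easy|]. apply pow_incr. lra. }
  assert (Hlim : forall n, is_lim_seq (u n) (l n)).
  { intros n. unfold u.
    replace (Finite (l n)) with (Rbar_mult ((4 * INR n + 1) * wallis2 n) ((PI / 2 * wallis2 n) ^ 2))
      by (simpl; f_equal; unfold l, term_7F6, wallis2; field).
    apply is_lim_seq_scal_l. simpl pow.
    pose proof (series_wallis2_lmoment n) as Hs.
    change (is_lim_seq (sum_n (fun r => wallis2 r * lmoment n r)) (PI / 2 * wallis2 n)) in Hs.
    apply is_lim_seq_mult'; [exact Hs|]. apply is_lim_seq_mult'; [exact Hs|].
    apply is_lim_seq_const. }
  assert (Hser : is_series l L).
  { apply (is_series_scal_l (PI ^ 2 / 4) term_7F6), Series_correct, ex_series_term_7F6. }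
  assert (Hl : forall n, 0 <= l n) by (intros n; specialize (Hul n 0%nat); lra).
  apply is_lim_seq_spec. intros eps.
  pose proof Hser as Hs. change (is_lim_seq (sum_n l) L) in Hs.
  apply is_lim_seq_spec in Hs.
  destruct (Hs (pos_div_2 eps)) as [N HN]. specialize (HN N (le_n N)).
  pose proof (is_lim_sum_n u l N Hlim) as HM. apply is_lim_seq_spec in HM.
  destruct (HM (pos_div_2 eps)) as [M0 HM0].
  exists (max N M0). intros M HMM. specialize (HM0 M ltac:(lia)).
  rewrite square_sum_beta_half. change (sum_n _ M) with (sum_n (fun n => u n M) M).
  assert (H1 : sum_n (fun n => u n M) M <= L).
  { apply Rle_trans with (sum_n l M).
    - apply sum_n_le. intros k. apply Hul.
    - now apply sum_n_le_series. }
  assert (H2 : sum_n (fun n => u n M) N <= sum_n (fun n => u n M) M).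
  { apply sum_n_mono; [intros k; apply Hul|lia]. }
  simpl in HN, HM0. apply Rabs_def2 in HN. apply Rabs_def2 in HM0.
  apply Rabs_def1; lra.
Qed.

(** * Landen's transformation *)

(** Coefficientwise, (n+1/2)^2/(n+1) - n = 1/(4(n+1)). *)
Lemma derive_PSeries_wallis2 (z : R) : Rabs z < 1 ->
  (1 - z) * PSeries (PS_derive wallis2) z = PSeries (fun k => wallis2 k / (4 * (INR k + 1))) z.
Proof.
  intros Hz. assert (Hr := CV_radius_ge_1 wallis2 z Rabs_wallis2 Hz).
  assert (ex_pseries (PS_derive wallis2) z) by now apply ex_pseries_derive.
  replace ((1 - z) * PSeries (PS_derive wallis2) z) with
    (PSeries (PS_derive wallis2) z - z * PSeries (PS_derive wallis2) z) by ring.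
  rewrite <- PSeries_incr_1, <- PSeries_minus; [|easy|now apply ex_pseries_incr_1].
  apply PSeries_ext. intros n.
  unfold PS_minus, PS_plus, PS_opp, PS_derive, PS_incr_1.
  assert (E : wallis2 (S n) = (INR n + 1 / 2) ^ 2 * wallis2 n / (INR n + 1) ^ 2).
  { rewrite <- wallis2_S. pose proof (pos_INR n). field. lra. }
  cbn -[INR wallis2]. rewrite E.
  destruct n as [|n]; [simpl; field|].
  rewrite !S_INR. pose proof (pos_INR n). field. lra.
Qed.

(** The hypergeometric equation of K in divergence form, (z (1-z) F')' = F/4. By the previous lemma,
    z (1-z) F' is the termwise antiderivative of F/4. *)
Lemma derive_PSeries_wallis2_flux (z : R) : Rabs z < 1 ->
  is_derive (fun z => z * (1 - z) * PSeries (PS_derive wallis2) z) z (PSeries wallis2 z / 4).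
Proof.
  intros Hz. set (q := fun k => wallis2 k / (4 * (INR k + 1))).
  assert (Hq : forall n, Rabs (PS_incr_1 q n) <= 1).
  { intros [|n]; unfold q; simpl.
    - change (Rabs 0 <= 1). rewrite Rabs_R0. lra.
    - pose proof (wallis2_pos n). pose proof (wallis2_le_1 n). pose proof (pos_INR n).
      rewrite Rabs_pos_eq; [|apply Rlt_le, Rdiv_lt_0_compat; lra].
      apply (Rle_div_l _ _ (4 * (INR n + 1))); lra. }
  apply (is_derive_ext_loc (PSeries (PS_incr_1 q))).
  - exists (mkposreal (1 - Rabs z) ltac:(lra)). intros y Hy.
    unfold ball in Hy; simpl in Hy.
    unfold AbsRing_ball, abs, minus, plus, opp in Hy; simpl in Hy.
    assert (Rabs y < 1).
    { replace y with (y + - z + z) by ring. pose proof (Rabs_triang (y + - z) z). lra. }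
    rewrite PSeries_incr_1, Rmult_assoc, derive_PSeries_wallis2 by easy. reflexivity.
  - replace (PSeries wallis2 z / 4) with (PSeries (PS_derive (PS_incr_1 q)) z).
    + apply is_derive_PSeries, CV_radius_ge_1; easy.
    + replace (PSeries wallis2 z / 4) with (/ 4 * PSeries wallis2 z) by field.
      rewrite <- PSeries_scal. apply PSeries_ext. intros n.
      unfold PS_derive, PS_incr_1, PS_scal, q. rewrite S_INR. unfold scal; simpl.
      unfold mult; simpl. pose proof (pos_INR n). field. lra.
Qed.

(** The square of the transformed modulus 2 sqrt(k) / (1+k). *)
Definition landen (k : R) : R := 4 * k / (1 + k) ^ 2.

Lemma landen_le (x y : R) : 0 <= x <= y -> y <= 1 -> landen x <= landen y.
Proof.
  intros H Hy. unfold landen. apply Rminus_le_0.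
  replace (4 * y / (1 + y) ^ 2 - 4 * x / (1 + x) ^ 2)
    with (4 * (y - x) * (1 - x * y) / ((1 + x) ^ 2 * (1 + y) ^ 2)) by (field; lra).
  apply Rdiv_le_0_compat.
  - apply Rmult_le_pos; nra.
  - apply Rmult_lt_0_compat; apply pow_lt; lra.
Qed.

Lemma landen_bounds (k : R) : 0 <= k < 1 -> 0 <= landen k < 1.
Proof.
  intros H. unfold landen. split.
  - apply Rdiv_le_0_compat; [lra|apply pow_lt; lra].
  - apply (Rlt_div_l _ _ ((1 + k) ^ 2)); [apply pow_lt; lra|nra].
Qed.

(* [k (1 - k^2) y' = D] and [D' = k y] is the equation of [K]; both sides satisfy it and are
   regular at 0, so their Wronskian [k (1 - k^2) (f g' - f' g)] vanishes. *)
Lemma landen_ode (F P F' : R -> R) (k : R) :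
  (forall z, 0 <= z < 1 -> is_derive F z (F' z)) ->
  (forall z, 0 <= z < 1 -> is_derive P z (F z / 4)) ->
  (forall z, 0 <= z < 1 -> z * (1 - z) * F' z = P z) ->
  (forall z, 0 <= z < 1 -> 0 < F z) -> F 0 = 1 ->
  0 <= k < 1 -> F (landen k) = (1 + k) * F (k ^ 2).
Proof.
  intros HF HP HFP Hpos H0 Hk.
  set (f := fun k => F (k ^ 2)). set (g := fun k => F (landen k) / (1 + k)).
  (* [Df] and [Dg] are k (1-k^2) f' and k (1-k^2) g'. Expressed through [P], they can be
     differentiated without a second derivative of [F], also at 0. *)
  set (Df := fun k => 2 * P (k ^ 2)).
  set (Dg := fun k => (1 + k) * P (landen k) - k * (1 - k) / (1 + k) * F (landen k)).
  set (f' := fun k => 2 * k * F' (k ^ 2)).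
  set (g' := fun k => 4 * (1 - k) / (1 + k) ^ 4 * F' (landen k) - F (landen k) / (1 + k) ^ 2).
  assert (Hsq : forall t, 0 <= t < 1 -> 0 <= t ^ 2 < 1) by (intros t Ht; nra).
  assert (Hf : forall t, 0 <= t < 1 -> is_derive f t (f' t)).
  { intros t Ht. unfold f, f'. pose proof (HF _ (Hsq t Ht)) as Hd. auto_derive.
    - now exists (F' (t ^ 2)).
    - replace (t * (t * 1)) with (t ^ 2) by ring.
      replace (Derive (fun x : R => F x) (t ^ 2)) with (F' (t ^ 2))
        by (symmetry; now apply is_derive_unique). ring. }
  assert (HDf : forall t, 0 <= t < 1 -> is_derive Df t (t * f t)).
  { intros t Ht. unfold f, Df. pose proof (HP _ (Hsq t Ht)) as Hd. auto_derive.
    - now exists (F (t ^ 2) / 4).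
    - replace (t * (t * 1)) with (t ^ 2) by ring.
      replace (Derive (fun x : R => P x) (t ^ 2)) with (F (t ^ 2) / 4)
        by (symmetry; now apply is_derive_unique). field. }
  assert (Hl : forall t, 0 <= t < 1 -> is_derive landen t (4 * (1 - t) / (1 + t) ^ 3)).
  { intros t Ht. unfold landen. auto_derive.
    - apply Rgt_not_eq. nra.
    - field. lra. }
  assert (HFl : forall t, 0 <= t < 1 ->
    is_derive (fun k => F (landen k)) t (4 * (1 - t) / (1 + t) ^ 3 * F' (landen t))).
  { intros t Ht. apply (is_derive_comp F landen); [|now apply Hl].
    apply HF, landen_bounds, Ht. }
  assert (HPl : forall t, 0 <= t < 1 ->
    is_derive (fun k => P (landen k)) t (4 * (1 - t) / (1 + t) ^ 3 * (F (landen t) / 4))).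
  { intros t Ht. apply (is_derive_comp P landen); [|now apply Hl].
    apply HP, landen_bounds, Ht. }
  assert (Hg : forall t, 0 <= t < 1 -> is_derive g t (g' t)).
  { intros t Ht. unfold g, g'. pose proof (HFl t Ht) as Hd. revert Hd.
    set (Fl := fun k => F (landen k)).
    change (F (landen t)) with (Fl t).
    change (is_derive Fl t (4 * (1 - t) / (1 + t) ^ 3 * F' (landen t)) ->
      is_derive (fun k => Fl k / (1 + k)) t
        (4 * (1 - t) / (1 + t) ^ 4 * F' (landen t) - Fl t / (1 + t) ^ 2)).
    clearbody Fl. intros Hd. auto_derive.
    - split; [eexists; exact Hd|split; [lra|easy]].
    - replace (Derive (fun x : R => Fl x) t) with (4 * (1 - t) / (1 + t) ^ 3 * F' (landen t))
        by (symmetry; now apply is_derive_unique). field. lra. }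
  assert (HDg : forall t, 0 <= t < 1 -> is_derive Dg t (t * g t)).
  { intros t Ht. unfold g, Dg. pose proof (HFl t Ht) as Hd1.
    pose proof (HPl t Ht) as Hd2.
    pose proof (HFP _ (landen_bounds t Ht)) as E. revert Hd1 Hd2 E.
    replace (landen t * (1 - landen t)) with (4 * t * (1 - t) ^ 2 / (1 + t) ^ 4)
      by (unfold landen; field; lra).
    set (Fl := fun k => F (landen k)). set (Pl := fun k => P (landen k)).
    change (F (landen t)) with (Fl t). change (P (landen t)) with (Pl t).
    change (is_derive Fl t (4 * (1 - t) / (1 + t) ^ 3 * F' (landen t)) ->
      is_derive Pl t (4 * (1 - t) / (1 + t) ^ 3 * (Fl t / 4)) ->
      4 * t * (1 - t) ^ 2 / (1 + t) ^ 4 * F' (landen t) = Pl t ->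
      is_derive (fun k => (1 + k) * Pl k - k * (1 - k) / (1 + k) * Fl k) t
        (t * (Fl t / (1 + t)))).
    clearbody Fl Pl. generalize (F' (landen t)) as d. intros d Hd1 Hd2 E. auto_derive.
    - split; [eexists; exact Hd2|]. split; [lra|]. split; [eexists; exact Hd1|easy].
    - replace (Derive (fun x : R => Fl x) t) with (4 * (1 - t) / (1 + t) ^ 3 * d)
        by (symmetry; now apply is_derive_unique).
      replace (Derive (fun x : R => Pl x) t) with (4 * (1 - t) / (1 + t) ^ 3 * (Fl t / 4))
        by (symmetry; now apply is_derive_unique).
      rewrite <- E. field. lra. }
  assert (Ef : forall t, 0 < t < 1 -> f' t = Df t / (t * (1 - t ^ 2))).
  { intros t Ht. unfold f', Df. rewrite <- HFP by (apply Hsq; lra). field. nra. }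
  assert (Eg : forall t, 0 < t < 1 -> g' t = Dg t / (t * (1 - t ^ 2))).
  { intros t Ht. unfold g', Dg. rewrite <- HFP by (apply landen_bounds; lra).
    generalize (F (landen t)) (F' (landen t)). intros x y. unfold landen.
    field. repeat split; nra. }
  assert (HW : forall x, 0 <= x < 1 -> f x * Dg x - g x * Df x = 0).
  { intros x Hx. set (W := fun t => f t * Dg t - g t * Df t).
    assert (Hd : forall t, 0 <= t < 1 -> is_derive W t (f' t * Dg t - g' t * Df t)).
    { intros t Ht. unfold W.
      replace (f' t * Dg t - g' t * Df t) with
        (minus (plus (mult (f' t) (Dg t)) (mult (f t) (t * g t)))
               (plus (mult (g' t) (Df t)) (mult (g t) (t * f t))))
        by (unfold minus, plus, opp, mult; simpl; ring).
      apply (is_derive_minus (fun t => f t * Dg t) (fun t => g t * Df t)).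
      - apply (is_derive_mult f Dg); [now apply Hf|now apply HDg|apply Rmult_comm].
      - apply (is_derive_mult g Df); [now apply Hg|now apply HDf|apply Rmult_comm]. }
    change (W x = 0). rewrite <- (zero_derive_eq W 0 x); [|lra| |].
    - unfold W, Dg, Df, landen.
      replace (4 * 0 / (1 + 0) ^ 2) with 0 by field. replace (0 ^ 2) with 0 by ring.
      rewrite <- HFP by lra. field.
    - intros t Ht. eexists. apply Hd. lra.
    - intros t Ht. replace 0 with (f' t * Dg t - g' t * Df t); [apply Hd; lra|].
      rewrite Ef, Eg by lra. field. nra. }
  assert (Hfp : forall t, 0 <= t < 1 -> 0 < f t) by (intros t Ht; apply Hpos, Hsq, Ht).
  (* The vanishing Wronskian makes g/f constant, and its value at 0 is 1. *)
  assert (HQ : g 0 / f 0 = g k / f k).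
  { assert (Hd : forall t, 0 <= t < 1 ->
      is_derive (fun t => g t / f t) t ((g' t * f t - g t * f' t) / f t ^ 2)).
    { intros t Ht. pose proof (Hfp t Ht).
      apply (is_derive_div g f); [now apply Hg|now apply Hf|lra]. }
    apply (zero_derive_eq (fun t => g t / f t)); [lra| |].
    - intros t Ht. eexists. apply Hd. lra.
    - intros t Ht. pose proof (Hfp t ltac:(lra)).
      replace 0 with ((g' t * f t - g t * f' t) / f t ^ 2); [apply Hd; lra|].
      rewrite Ef, Eg by lra.
      replace (Dg t / (t * (1 - t ^ 2)) * f t - g t * (Df t / (t * (1 - t ^ 2))))
        with ((f t * Dg t - g t * Df t) / (t * (1 - t ^ 2))) by (field; nra).
      rewrite HW by lra. field. repeat split; nra. }
  unfold g, f, landen in HQ. fold (landen k) in HQ.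
  replace (4 * 0 / (1 + 0) ^ 2) with 0 in HQ by field.
  rewrite (pow_ne_zero 2) in HQ by easy. rewrite H0 in HQ.
  pose proof (Hfp k Hk) as Hp. unfold f in Hp.
  replace (1 / (1 + 0) / 1) with 1 in HQ by field.
  replace (F (landen k)) with (F (landen k) / (1 + k) / F (k ^ 2) * ((1 + k) * F (k ^ 2)))
    by (field; lra).
  rewrite <- HQ. ring.
Qed.

Lemma PSeries_wallis2_pos (z : R) : 0 <= z < 1 -> 0 < PSeries wallis2 z.
Proof.
  intros Hz. apply Rlt_le_trans with (sum_n (fun k => wallis2 k * z ^ k) 0).
  - rewrite sum_O. unfold wallis2. simpl. lra.
  - apply sum_n_le_PSeries; [|easy].
    intros n. pose proof (wallis2_pos n). pose proof (wallis2_le_1 n). lra.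
Qed.

(** Since 1 - [landen k] is the square of (1-k)/(1+k), this is K'((1-k)/(1+k)) = (1+k) K(k). *)
Lemma PSeries_wallis2_landen (k : R) : 0 <= k < 1 ->
  PSeries wallis2 (landen k) = (1 + k) * PSeries wallis2 (k ^ 2).
Proof.
  intros Hk.
  assert (Hz : forall z, 0 <= z < 1 -> Rabs z < 1)
    by (intros z Hz; rewrite Rabs_pos_eq; lra).
  apply landen_ode with (P := fun z => z * (1 - z) * PSeries (PS_derive wallis2) z)
    (F' := PSeries (PS_derive wallis2)).
  - intros z H. apply is_derive_PSeries, CV_radius_ge_1; [apply Rabs_wallis2|now apply Hz].
  - intros z H. now apply derive_PSeries_wallis2_flux, Hz.
  - reflexivity.
  - apply PSeries_wallis2_pos.
  - rewrite PSeries_0. unfold wallis2. simpl. ring.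
  - exact Hk.
Qed.

(** * Square and triangular partial sums *)

Lemma sum_antidiag (f : nat -> nat -> R) (M : nat) :
  sum_n (antidiag f) M = sum_n (fun m => sum_n (f m) (M - m)) M.
Proof.
  induction M as [|M IH].
  - rewrite !sum_O. unfold antidiag. now rewrite !sum_O.
  - rewrite sum_Sn, IH. unfold antidiag. rewrite !sum_Sn, Nat.sub_diag, sum_O.
    rewrite plus_assoc. f_equal.
    rewrite <- sum_n_plus. apply sum_n_ext_loc. intros m Hm.
    replace (S M - m)%nat with (S (M - m)) by lia. now rewrite sum_Sn.
Qed.

Lemma sum_n_le_loc (u v : nat -> R) (n : nat) :
  (forall k, (k <= n)%nat -> u k <= v k) -> sum_n u n <= sum_n v n.
Proof.
  induction n as [|n IH]; intros H; [rewrite !sum_O; now apply H|].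
  rewrite !sum_Sn. apply Rplus_le_compat; [apply IH|apply H]; auto with arith.
Qed.

Lemma triangle_le_square (f : nat -> nat -> R) (M : nat) :
  (forall m r, 0 <= f m r) -> sum_n (antidiag f) M <= square_sum f M.
Proof.
  intros Hf. rewrite sum_antidiag. apply sum_n_le_loc. intros k Hk.
  apply sum_n_mono; [easy|lia].
Qed.

Lemma square_le_triangle (f : nat -> nat -> R) (M : nat) :
  (forall m r, 0 <= f m r) -> square_sum f M <= sum_n (antidiag f) (2 * M).
Proof.
  intros Hf. rewrite sum_antidiag.
  apply Rle_trans with (sum_n (fun m => sum_n (f m) (2 * M - m)) M).
  - apply sum_n_le_loc. intros k Hk. apply sum_n_mono; [easy|lia].
  - apply sum_n_mono; [|lia]. intros k.
    apply Rle_trans with (sum_n (f k) 0); [rewrite sum_O; easy|].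
    apply sum_n_mono; [easy|lia].
Qed.

(** The triangle of size M lies in the square of size M, which lies in the triangle of size 2M. With
    nonnegative entries each family of partial sums squeezes the other. *)
Lemma series_antidiag_square (f : nat -> nat -> R) (l : R) :
  (forall m r, 0 <= f m r) ->
  is_series (antidiag f) l <-> is_lim_seq (square_sum f) l.
Proof.
  intros Hf. change (is_series (antidiag f) l) with (is_lim_seq (sum_n (antidiag f)) l).
  assert (Hpos : forall k, 0 <= antidiag f k).
  { intros k. unfold antidiag. apply Rle_trans with (sum_n (fun i => f i (k - i)%nat) 0).
    - rewrite sum_O. apply Hf.
    - apply sum_n_mono; [easy|lia]. }
  split; intros H.
  - apply is_lim_seq_le_le with (u := sum_n (antidiag f))
      (w := fun M => sum_n (antidiag f) (2 * M)).
    + intros M. split; [now apply triangle_le_square|now apply square_le_triangle].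
    + exact H.
    + apply (is_lim_seq_subseq (sum_n (antidiag f)) l (fun M => (2 * M)%nat)); [|exact H].
      apply eventually_subseq. intros n. lia.
  - apply is_lim_seq_spec in H. apply is_lim_seq_spec. intros eps.
    destruct (H eps) as [N HN]. exists (2 * N)%nat. intros M HM.
    pose proof (HN N (le_n N)) as H1. pose proof (HN M ltac:(lia)) as H2.
    apply Rabs_def2 in H1. apply Rabs_def2 in H2.
    pose proof (triangle_le_square f M Hf). pose proof (square_le_triangle f N Hf).
    pose proof (sum_n_mono (antidiag f) (2 * N) M Hpos HM).
    apply Rabs_def1; lra.
Qed.

Definition wallis2_conv (k : nat) : R := antidiag (fun m r => wallis2 m * wallis2 r) k.

(** A weight depending on m + r only factors out of an antidiagonal. The weight [beta_half] belongs
    to the integral of K'^2, and 1/(2k+1) to that of K^2. *)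
Lemma antidiag_wallis2 (g : nat -> R) (k : nat) :
  antidiag (fun m r => wallis2 m * wallis2 r * g (m + r)%nat) k = wallis2_conv k * g k.
Proof.
  unfold wallis2_conv, antidiag. rewrite <- (sum_n_mult_r (K := R_Ring) (g k)).
  apply sum_n_ext_loc. intros i Hi. now replace (i + (k - i))%nat with k by lia.
Qed.

(** A crude count of the terms, enough to keep the coefficients bounded by 1 after division by
    2k+1. *)
Lemma wallis2_conv_bounds (k : nat) : 0 <= wallis2_conv k <= INR k + 1.
Proof.
  unfold wallis2_conv, antidiag.
  assert (H : forall i, 0 <= wallis2 i * wallis2 (k - i) <= 1).
  { intros i. pose proof (wallis2_pos i). pose proof (wallis2_le_1 i).
    pose proof (wallis2_pos (k - i)). pose proof (wallis2_le_1 (k - i)). nra. }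
  split.
  - apply Rle_trans with (sum_n (fun i => wallis2 i * wallis2 (k - i)) 0); [rewrite sum_O; apply H|].
    apply sum_n_mono; [apply H|lia].
  - rewrite <- S_INR, <- (Rmult_1_r (INR (S k))), <- sum_n_const.
    apply sum_n_le. intros i. apply H.
Qed.

Lemma is_series_wallis2_conv (z : R) : 0 <= z < 1 ->
  is_series (fun k => wallis2_conv k * z ^ k) (PSeries wallis2 z ^ 2).
Proof.
  intros Hz. assert (Hz' : Rabs z < 1) by (rewrite Rabs_pos_eq; lra).
  pose proof (CV_radius_ge_1 wallis2 z Rabs_wallis2 Hz') as Hr.
  assert (Hp : is_pseries wallis2 z (PSeries wallis2 z)).
  { apply PSeries_correct. now apply CV_radius_inside. }
  pose proof (is_pseries_mult wallis2 wallis2 z _ _ Hp Hp Hr Hr) as H.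
  replace (PSeries wallis2 z ^ 2) with (PSeries wallis2 z * PSeries wallis2 z) by ring.
  apply (is_series_ext (fun k => scal (pow_n z k) (PS_mult wallis2 wallis2 k))); [|exact H].
  intros k. rewrite pow_n_pow. unfold PS_mult, wallis2_conv, antidiag. rewrite sum_n_Reals.
  apply Rmult_comm.
Qed.

(** * The integrals of K^2 and K'^2 *)

(* [vint k y] is the integral of [(1 - u^2)^k] over [[y, 1]]. *)
Fixpoint vint (k : nat) (y : R) : R :=
  match k with
  | O => 1 - y
  | S j => ((2 * INR j + 2) * vint j y - y * (1 - y ^ 2) ^ S j) / (2 * INR j + 3)
  end.

Lemma vint_0 (k : nat) : vint k 0 = beta_half k.
Proof.
  induction k as [|k IH]; cbn -[pow INR]; [ring|]. rewrite IH.
  pose proof (pos_INR k). field. lra.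
Qed.

Lemma vint_1 (k : nat) : vint k 1 = 0.
Proof.
  induction k as [|k IH]; cbn -[pow INR]; [ring|]. rewrite IH.
  replace (1 - 1 ^ 2) with 0 by ring. rewrite pow_i by lia.
  pose proof (pos_INR k). field. lra.
Qed.

Lemma is_derive_vint (k : nat) (y : R) : is_derive (vint k) y (- (1 - y ^ 2) ^ k).
Proof.
  induction k as [|k IH].
  - simpl. auto_derive; [easy|ring].
  - cbn [vint]. pose proof (pos_INR k). revert IH. generalize (vint k) as f. intros f IH.
    auto_derive.
    + now exists (- (1 - y ^ 2) ^ k).
    + replace (Derive (fun x : R => f x) y) with (- (1 - y ^ 2) ^ k)
        by (symmetry; now apply is_derive_unique).
      change (match k with 0%nat => 1 | S _ => INR k + 1 end) with (INR (S k)).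
      rewrite S_INR. change (Init.Nat.pred (S k)) with k.
      replace (1 + - (y * (y * 1))) with (1 - y ^ 2) by ring.
      change ((1 - y ^ 2) ^ S k) with ((1 - y ^ 2) * (1 - y ^ 2) ^ k).
      generalize ((1 - y ^ 2) ^ k). intros q. field. lra.
Qed.

Lemma vint_le (k : nat) (y : R) : 0 <= y <= 1 -> vint k y <= beta_half k.
Proof.
  intros Hy. rewrite <- vint_0. apply Ropp_le_cancel.
  apply (nonneg_derive_le (fun y => - vint k y) (fun y => (1 - y ^ 2) ^ k)); [lra| |].
  - intros t Ht. rewrite <- (Ropp_involutive ((1 - t ^ 2) ^ k)).
    apply (is_derive_opp (vint k)), is_derive_vint.
  - intros t Ht. apply pow_le. nra.
Qed.

(** The integral of K^2 over [0, x], up to the factor 4/PI^2, integrated term by term. *)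
Definition square_primitive (x : R) : R :=
  x * PSeries (fun k => wallis2_conv k / (2 * INR k + 1)) (x ^ 2).

Lemma wallis2_conv_div_bounds (k : nat) : 0 <= wallis2_conv k / (2 * INR k + 1) <= 1.
Proof.
  pose proof (wallis2_conv_bounds k). pose proof (pos_INR k). split.
  - apply Rdiv_le_0_compat; lra.
  - apply (Rle_div_l _ _ (2 * INR k + 1)); lra.
Qed.

Lemma is_derive_square_primitive (x : R) : 0 <= x < 1 ->
  is_derive square_primitive x (PSeries wallis2 (x ^ 2) ^ 2).
Proof.
  intros Hx. unfold square_primitive. set (u := fun k => wallis2_conv k / (2 * INR k + 1)).
  assert (Hu : forall n, Rabs (u n) <= 1).
  { intros n. unfold u. pose proof (wallis2_conv_div_bounds n). rewrite Rabs_pos_eq; lra. }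
  assert (Hz : 0 <= x ^ 2 < 1) by nra.
  assert (Hz' : Rabs (x ^ 2) < 1) by (rewrite Rabs_pos_eq; lra).
  assert (Hr := CV_radius_ge_1 u _ Hu Hz').
  assert (Hd := is_derive_PSeries u _ Hr).
  assert (E : PSeries u (x ^ 2) + 2 * (x ^ 2 * PSeries (PS_derive u) (x ^ 2))
              = PSeries wallis2 (x ^ 2) ^ 2).
  { rewrite <- (is_series_unique _ _ (is_series_wallis2_conv _ Hz)).
    change (Series (fun k => wallis2_conv k * (x ^ 2) ^ k)) with (PSeries wallis2_conv (x ^ 2)).
    rewrite <- PSeries_incr_1. symmetry. rewrite <- (Rmult_1_l (PSeries u _)).
    apply PSeries_linear.
    - now apply CV_radius_inside.
    - now apply ex_pseries_incr_1, ex_pseries_derive.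
    - intros n. unfold PS_incr_1, PS_derive, u. destruct n as [|n].
      + cbn. field.
      + pose proof (pos_INR n). rewrite S_INR. field. lra. }
  rewrite <- E. revert Hd. generalize (PSeries (PS_derive u) (x ^ 2)) as d.
  generalize (PSeries u) as f. intros f d Hd. auto_derive.
  - now exists d.
  - replace (x * (x * 1)) with (x ^ 2) by ring.
    replace (Derive (fun x : R => f x) (x ^ 2)) with d
      by (symmetry; now apply is_derive_unique).
    ring.
Qed.

Definition cayley (x : R) : R := (1 - x) / (1 + x).

(** With the same factor 4/PI^2, the integral over [[cayley x], 1] of the N-th partial sum of K'^2
    in powers of 1 - y^2. *)
Definition vint_sum (N : nat) (x : R) : R :=
  sum_n (fun k => wallis2_conv k * vint k (cayley x)) N.

Definition conv_tail (N : nat) (z : R) : R :=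
  PSeries wallis2 z ^ 2 - sum_n (fun k => wallis2_conv k * z ^ k) N.

Lemma is_derive_vint_sum (N : nat) (x : R) : 0 <= x ->
  is_derive (vint_sum N) x
    (2 / (1 + x) ^ 2 * sum_n (fun k => wallis2_conv k * landen x ^ k) N).
Proof.
  intros Hx. rewrite <- (sum_n_mult_l (K := R_Ring)).
  apply (is_derive_sum_n (fun k x => wallis2_conv k * vint k (cayley x))).
  intros k _.
  assert (Hc : is_derive cayley x (- (2 / (1 + x) ^ 2))).
  { unfold cayley. auto_derive; [lra|]. field. lra. }
  pose proof (is_derive_comp (vint k) cayley x _ _ (is_derive_vint k (cayley x)) Hc) as H.
  apply (is_derive_scal _ _ (wallis2_conv k)) in H.
  replace (1 - cayley x ^ 2) with (landen x) in H
    by (unfold cayley, landen; field; lra).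
  replace (mult (2 / (1 + x) ^ 2) (wallis2_conv k * landen x ^ k))
    with (wallis2_conv k * scal (- (2 / (1 + x) ^ 2)) (- landen x ^ k)); [exact H|].
  unfold scal, mult; simpl; unfold mult; simpl. ring.
Qed.

Lemma conv_tail_bounds (N : nat) (y z : R) : 0 <= y <= z -> z < 1 ->
  0 <= conv_tail N y <= conv_tail N z.
Proof.
  intros H Hz. unfold conv_tail. split.
  - apply (proj1 (Rminus_le_0 _ _)). apply sum_n_le_series; [|apply is_series_wallis2_conv; lra].
    intros n. apply Rmult_le_pos; [apply wallis2_conv_bounds|apply pow_le; lra].
  - assert (Hs : is_series (fun n => wallis2_conv n * z ^ n - wallis2_conv n * y ^ n)
                   (PSeries wallis2 z ^ 2 - PSeries wallis2 y ^ 2))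
      by (apply (is_series_minus (V := R_NormedModule)); apply is_series_wallis2_conv; lra).
    assert (Hp : forall n, 0 <= wallis2_conv n * z ^ n - wallis2_conv n * y ^ n).
    { intros n. pose proof (wallis2_conv_bounds n).
      assert (y ^ n <= z ^ n) by (apply pow_incr; lra). nra. }
    pose proof (sum_n_le_series _ _ N Hp Hs) as Hle.
    enough (E : sum_n (fun n => wallis2_conv n * z ^ n - wallis2_conv n * y ^ n) N
      = sum_n (fun n => wallis2_conv n * z ^ n) N - sum_n (fun n => wallis2_conv n * y ^ n) N) by lra.
    clear. induction N as [|N IH]; [now rewrite !sum_O|].
    rewrite !sum_Sn, IH. unfold plus; simpl. ring.
Qed.

(** As 1 - ([cayley x])^2 = [landen x], the chain rule puts the partial sum at [landen x] into the
    second derivative. Landen's transformation writes 2 F(x^2)^2 as 2/(1+x)^2 F([landen x])^2, so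
    only the tail of F^2 is left. *)
Lemma is_derive_primitive_gap (N : nat) (x : R) : 0 <= x < 1 ->
  is_derive (fun x => 2 * square_primitive x - vint_sum N x) x
    (2 / (1 + x) ^ 2 * conv_tail N (landen x)).
Proof.
  intros Hx.
  replace (2 / (1 + x) ^ 2 * conv_tail N (landen x)) with
    (minus (2 * PSeries wallis2 (x ^ 2) ^ 2)
       (2 / (1 + x) ^ 2 * sum_n (fun k => wallis2_conv k * landen x ^ k) N)).
  - apply (is_derive_minus (fun x => 2 * square_primitive x) (vint_sum N)).
    + apply is_derive_scal, is_derive_square_primitive, Hx.
    + apply is_derive_vint_sum. lra.
  - unfold conv_tail. rewrite (PSeries_wallis2_landen x Hx).
    unfold minus, plus, opp; simpl. field. lra.
Qed.

Lemma primitive_gap_0 (N : nat) : 2 * square_primitive 0 - vint_sum N 0 = 0.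
Proof.
  unfold square_primitive, vint_sum, cayley.
  replace ((1 - 0) / (1 + 0)) with 1 by field.
  rewrite (sum_n_ext _ (fun _ => 0)) by (intros k; rewrite vint_1; apply Rmult_0_r).
  rewrite sum_n_const. ring.
Qed.

Lemma vint_sum_le_primitive (N : nat) (x : R) : 0 <= x < 1 ->
  vint_sum N x <= 2 * square_primitive x.
Proof.
  intros Hx. apply Rminus_le_0. rewrite <- (primitive_gap_0 N).
  apply (nonneg_derive_le (fun x => 2 * square_primitive x - vint_sum N x)
    (fun x => 2 / (1 + x) ^ 2 * conv_tail N (landen x))); [lra| |].
  - intros t Ht. apply is_derive_primitive_gap. lra.
  - intros t Ht. pose proof (landen_bounds t ltac:(lra)). apply Rmult_le_pos.
    + apply Rdiv_le_0_compat; [lra|apply pow_lt; lra].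
    + apply (conv_tail_bounds N _ (landen t)); lra.
Qed.

(** On [0, x] the gap grows at a rate of at most twice the tail at [landen x], because the tail is
    increasing and 2/(1+t)^2 <= 2. *)
Lemma primitive_le_vint_sum (N : nat) (x : R) : 0 <= x < 1 ->
  2 * square_primitive x <= vint_sum N x + 2 * conv_tail N (landen x) * x.
Proof.
  intros Hx. set (tau := 2 * conv_tail N (landen x)).
  pose proof (primitive_gap_0 N) as H0.
  enough (tau * 0 - (2 * square_primitive 0 - vint_sum N 0)
    <= tau * x - (2 * square_primitive x - vint_sum N x)) by lra.
  apply (nonneg_derive_le (fun x => tau * x - (2 * square_primitive x - vint_sum N x))
    (fun t => tau - 2 / (1 + t) ^ 2 * conv_tail N (landen t))); [lra| |].
  - intros t Ht.
    apply (is_derive_minus (fun x => tau * x) (fun x => 2 * square_primitive x - vint_sum N x)).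
    + auto_derive; [easy|ring].
    + apply is_derive_primitive_gap. lra.
  - intros t Ht. pose proof (landen_bounds t ltac:(lra)). pose proof (landen_bounds x Hx).
    pose proof (landen_le t x ltac:(lra) ltac:(lra)).
    pose proof (conv_tail_bounds N (landen t) (landen x) ltac:(lra) ltac:(lra)).
    assert (2 / (1 + t) ^ 2 <= 2).
    { apply (Rle_div_l _ _ ((1 + t) ^ 2)); [apply pow_lt; lra|nra]. }
    assert (0 <= 2 / (1 + t) ^ 2).
    { apply Rdiv_le_0_compat; [lra|apply pow_lt; lra]. }
    unfold tau. nra.
Qed.

Lemma cayley_bounds (x : R) : 0 <= x <= 1 -> 0 <= cayley x <= 1.
Proof.
  intros Hx. unfold cayley. split; [apply Rdiv_le_0_compat; lra|].
  apply (Rle_div_l _ _ (1 + x)); lra.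
Qed.

(** For fixed x < 1 the tail at [landen x] tends to 0 as N grows, and each [vint k] is at most its
    value [beta_half k] at 0. *)
Lemma primitive_le (x l : R) : 0 <= x < 1 ->
  is_series (fun k => wallis2_conv k * beta_half k) l -> 2 * square_primitive x <= l.
Proof.
  intros Hx Hl.
  assert (Hlim : is_lim_seq (fun N => l + 2 * conv_tail N (landen x) * x) l).
  { pose proof (is_series_wallis2_conv _ (landen_bounds x Hx)) as Hs.
    set (F := PSeries wallis2 (landen x) ^ 2) in *.
    change (is_lim_seq (sum_n (fun k => wallis2_conv k * landen x ^ k)) F) in Hs.
    replace (Finite l) with (Finite (l + 2 * (F - F) * x)) by (f_equal; ring).
    apply is_lim_seq_plus'; [apply is_lim_seq_const|].
    apply is_lim_seq_mult'; [|apply is_lim_seq_const].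
    apply is_lim_seq_mult'; [apply is_lim_seq_const|].
    apply is_lim_seq_minus'; [apply is_lim_seq_const|exact Hs]. }
  apply (is_lim_seq_le (fun _ => 2 * square_primitive x) _ (2 * square_primitive x) l
    ) with (2 := is_lim_seq_const _) (3 := Hlim).
  intros N. apply Rle_trans with (1 := primitive_le_vint_sum N x Hx).
  apply Rplus_le_compat_r.
  apply Rle_trans with (sum_n (fun k => wallis2_conv k * beta_half k) N).
  - apply sum_n_le. intros k. apply Rmult_le_compat_l; [apply wallis2_conv_bounds|].
    apply vint_le, cayley_bounds. lra.
  - apply sum_n_le_series; [|exact Hl]. intros k. pose proof (beta_half_pos k).
    apply Rmult_le_pos; [apply wallis2_conv_bounds|lra].
Qed.

(* The map [cayley] turns the integral of [K(sqrt (1 - y^2))^2] over [[0,1]] into twice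
   the integral of [K(x)^2], by Landen's transformation. *)
Lemma series_wallis2_conv_odd (l : R) : is_series (fun k => wallis2_conv k * beta_half k) l ->
  is_series (fun k => wallis2_conv k / (2 * INR k + 1)) (l / 2).
Proof.
  intros Hl. set (u := fun k => wallis2_conv k / (2 * INR k + 1)).
  assert (Hu : forall n, 0 <= u n <= 1) by exact wallis2_conv_div_bounds.
  destruct (is_series_nonneg_bounded u (l / 2)) as [q [Hq Hle]].
  - apply Hu.
  - intros N.
    (* For x < 1 this polynomial is at most [square_primitive x] <= l/2; continuity carries the
       bound to x = 1. *)
    set (f := fun x => x * sum_n (fun k => u k * (x ^ 2) ^ k) N).
    replace (sum_n u N) with (f 1).
    2:{ unfold f. rewrite Rmult_1_l. apply sum_n_ext. intros k.
        now rewrite !pow1, Rmult_1_r. }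
    apply (le_at_left f 0); [lra| |].
    + apply (continuous_mult (K := R_AbsRing) (fun x => x)); [apply continuous_id|].
      apply (continuous_sum_n (fun k x => u k * (x ^ 2) ^ k)). intros k.
      apply (ex_derive_continuous (fun x => u k * (x ^ 2) ^ k)). auto_derive. easy.
    + intros x Hx. pose proof (primitive_le x l Hx Hl).
      apply Rle_trans with (square_primitive x); [|lra].
      unfold f, square_primitive. apply Rmult_le_compat_l; [easy|].
      apply sum_n_le_PSeries; [exact Hu|nra].
  - replace (l / 2) with q; [exact Hq|]. apply Rle_antisym; [easy|].
    (* For the converse, [cayley 1] = 0 makes [vint_sum N 1] a partial sum of l, and for x < 1
       [vint_sum N x] is at most 2 q. *)
    enough (l <= 2 * q) by lra.
    apply (is_lim_seq_le (sum_n (fun k => wallis2_conv k * beta_half k)) (fun _ => 2 * q) l (2 * q)).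
    2: exact Hl. 2: apply is_lim_seq_const.
    intros N. replace (sum_n (fun k => wallis2_conv k * beta_half k) N) with (vint_sum N 1).
    2:{ unfold vint_sum, cayley. replace ((1 - 1) / (1 + 1)) with 0 by field.
        apply sum_n_ext. intros k. now rewrite vint_0. }
    apply (le_at_left (vint_sum N) 0); [lra| |].
    + apply (ex_derive_continuous (vint_sum N)). eexists. apply is_derive_vint_sum. lra.
    + intros x Hx. apply Rle_trans with (1 := vint_sum_le_primitive N x Hx).
      unfold square_primitive. fold u.
      assert (0 <= PSeries u (x ^ 2) <= q); [|nra]. split.
      * apply Rle_trans with (sum_n (fun k => u k * (x ^ 2) ^ k) 0).
        -- rewrite sum_O. simpl. pose proof (Hu 0%nat). lra.
        -- apply sum_n_le_PSeries; [easy|nra].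
      * apply (PSeries_le_series u u); [|nra|easy]. intros n. pose proof (Hu n). lra.
Qed.

(** Square sums weighted by [beta_half] pass to antidiagonals, where Landen's transformation halves
    the value and changes the weight to 1/(2k+1). Back in squares, these are the partial sums of c_n
    b_n. *)
Lemma series_c_b :
  is_series (fun n => c n * b n) (PI ^ 2 / 8 * Series term_7F6).
Proof.
  set (L := PI ^ 2 / 4 * Series term_7F6).
  assert (Hw : is_series (fun k => wallis2_conv k * beta_half k) L).
  { apply (is_series_ext (antidiag (fun m r => wallis2 m * wallis2 r * beta_half (m + r)))).
    - intros k. apply antidiag_wallis2.
    - apply series_antidiag_square; [|exact is_lim_square_sum_beta_half].
      intros m r. pose proof (wallis2_pos m). pose proof (wallis2_pos r).
      pose proof (beta_half_pos (m + r)).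
      apply Rmult_le_pos; [nra|lra]. }
  apply series_wallis2_conv_odd in Hw. replace (L / 2) with (PI ^ 2 / 8 * Series term_7F6) in Hw
    by (unfold L; field).
  change (is_lim_seq (sum_n (fun n => c n * b n)) (PI ^ 2 / 8 * Series term_7F6)).
  apply (is_lim_seq_ext (square_sum (fun m r => wallis2 m * wallis2 r / (2 * INR (m + r) + 1))));
    [intros M; symmetry; apply sum_c_b|].
  apply series_antidiag_square.
  - intros m r. pose proof (wallis2_pos m). pose proof (wallis2_pos r).
    pose proof (pos_INR (m + r)).
    apply Rdiv_le_0_compat; [nra|lra].
  - apply (is_series_ext (fun k => wallis2_conv k / (2 * INR k + 1))); [|exact Hw].
    intros k. symmetry. apply (antidiag_wallis2 (fun k => / (2 * INR k + 1))).
Qed.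

Theorem theorem4p1 :
  ex_series (pFq_term upper lower 1) /\
  is_series (fun n : nat => c n * b n) (PI ^ 2 / 8 * pFq upper lower 1) /\
  (is_s40 (PI ^ 2 / 2 * Series (fun n : nat => c n * b n)) ->
   is_s40 (PI ^ 4 / 16 * pFq upper lower 1)).
Proof.
  assert (E : pFq upper lower 1 = Series term_7F6)
    by (apply Series_ext, pFq_term_upper_lower).
  rewrite E. split; [|split].
  - apply (ex_series_ext term_7F6); [|exact ex_series_term_7F6].
    intros n. symmetry. apply pFq_term_upper_lower.
  - exact series_c_b.
  - rewrite (is_series_unique _ _ series_c_b).
    replace (PI ^ 2 / 2 * (PI ^ 2 / 8 * Series term_7F6))
      with (PI ^ 4 / 16 * Series term_7F6) by field.
    easy.
Qed.
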